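(* Let $b_1,b_2,c_1,c_2,h_1,h_2>0$ and consider the system $$x_{n+1}=\frac{b_1x_n}{1+x_n+c_1y_n}+h_1,\qquad y_{n+1}=\frac{b_2y_n}{1+y_n+c_2x_n}+h_2,\qquad n=0,1,\ldots,\quad (x_0,y_0)\in[0,\infty)^2.$$ In the case where this system has exactly two distinct equilibria in $[0,\infty)^2$ given by a locally asymptotically stable point $(\overline{x}_1,\overline{y}_1)$ and a non-hyperbolic fixed point $(\overline{x}_2,\overline{y}_2)$, there exists a curve $\mathcal{C}\subset[0,\infty)^2$ through $(\overline{x}_2,\overline{y}_2)$ which is invariant, is a subset of the basin of attraction of $(\overline{x}_2,\overline{y}_2)$, is tangential at $(\overline{x}_2,\overline{y}_2)$ to the eigenspace of the Jacobian of the map there associated with its eigenvalue of smaller absolute value, is the graph of a strictly increasing continuous function of the first coordinate on an interval, has endpoints only on the boundary of $[0,\infty)^2$ (or at infinity), and separates $[0,\infty)^2$ into the two connected invariant sets $$\mathcal{W}_-=\{\mathrm{x}\in[0,\infty)^2\setminus\mathcal{C}:\exists\,\mathrm{y}\in\mathcal{C},\ \mathrm{x}\preceq_{se}\mathrm{y}\},\qquad \mathcal{W}_+=\{\mathrm{x}\in[0,\infty)^2\setminus\mathcal{C}:\exists\,\mathrm{y}\in\mathcal{C},\ \mathrm{y}\preceq_{se}\mathrm{x}\},$$ such that one of $\mathcal{W}_-$ or $\mathcal{W}_+$ is the basin of attraction of $(\overline{x}_1,\overline{y}_1)$, and the complement of such set (in $[0,\infty)^2$) is the basin of attraction of $(\overline{x}_2,\overline{y}_2)$.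 Moreover, for every $\mathrm{x}\in\mathcal{W}_-$ (respectively $\mathrm{x}\in\mathcal{W}_+$), $T^n(\mathrm{x})\in\mathrm{int}\,\mathcal{Q}_2(\overline{x}_2,\overline{y}_2)$ (respectively $\mathrm{int}\,\mathcal{Q}_4(\overline{x}_2,\overline{y}_2)$) for all large $n$, where $T$ is the map of the system.
   Context: $T(x,y)=\left(\frac{b_1x}{1+x+c_1y}+h_1,\frac{b_2y}{1+y+c_2x}+h_2\right)$ on $[0,\infty)^2$. A set $\mathcal{A}$ is invariant if $T(\mathcal{A})\subset\mathcal{A}$; the basin of attraction of a fixed point $\overline{\mathrm{x}}$ is the set of $\mathrm{x}\in[0,\infty)^2$ with $T^n(\mathrm{x})\to\overline{\mathrm{x}}$. South-East order: $(x,y)\preceq_{se}(s,t)$ iff $x\le s$ and $y\ge t$. Quadrants: $\mathcal{Q}_2(x,y)=\{(u,v):u\le x,\ v\ge y\}$, $\mathcal{Q}_4(x,y)=\{(u,v):u\ge x,\ v\le y\}$. A fixed point is non-hyperbolic if the Jacobian of $T$ there has an eigenvalue of modulus one. *)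

(* Defs.v *)
From mathcomp Require Export all_boot all_order all_algebra.
From mathcomp Require Export all_classical all_reals all_analysis.
From mathcomp Require Export complex.

Set Implicit Arguments.
Unset Strict Implicit.
Unset Printing Implicit Defensive.

Export Order.TTheory GRing.Theory Num.Theory.
Export numFieldNormedType.Exports.


Local Open Scope ring_scope.
Local Open Scope classical_set_scope.

(* The formula is total on R * R, but the dynamics is only ever considered on
   [quadrant], where both denominators are at least 1. *)
Definition sysmap {R : realType} (b1 b2 c1 c2 h1 h2 : R) (p : R * R) : R * R :=
  (b1 * p.1 / (1 + p.1 + c1 * p.2) + h1,
   b2 * p.2 / (1 + p.2 + c2 * p.1) + h2).

Definition quadrant {R : realType} : set (R * R) :=
  [set p | 0 <= p.1 /\ 0 <= p.2].

Definition equilibria {R : realType} (F : R * R -> R * R) : set (R * R) :=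
  [set p | quadrant p /\ F p = p].

Definition invariant_set {R : realType} (F : R * R -> R * R)
  (A : set (R * R)) : Prop := F @` A `<=` A.

Definition basin {R : realType} (F : R * R -> R * R) (p : R * R) :
    set (R * R) :=
  [set q | quadrant q /\ iter n F q @[n --> \oo] --> p].

Definition loc_asympt_stable {R : realType} (F : R * R -> R * R)
    (p : R * R) : Prop :=
  (forall U, nbhs p U -> exists2 V, nbhs p V &
     forall q, V q -> quadrant q -> forall n, U (iter n F q)) /\
  (exists2 V, nbhs p V & V `&` quadrant `<=` basin F p).

Definition le_se {R : realType} (p q : R * R) : Prop :=
  p.1 <= q.1 /\ q.2 <= p.2.

Definition Q2 {R : realType} (p : R * R) : set (R * R) :=
  [set q | q.1 <= p.1 /\ p.2 <= q.2].

Definition Q4 {R : realType} (p : R * R) : set (R * R) :=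
  [set q | p.1 <= q.1 /\ q.2 <= p.2].

Definition proj2 {R : realType} (i : 'I_2) (p : R * R) : R :=
  if i == 0 then p.1 else p.2.

(* Entry (i, j) is the partial derivative of the i-th component with respect
   to the j-th variable, so the matrix acts on column vectors. *)
Definition jacobian2 {R : realType} (F : R * R -> R * R) (p : R * R) :
    'M[R]_2 :=
  \matrix_(i, j)
    if j == 0 then (fun t => proj2 i (F (t, p.2)))^`() p.1
    else (fun t => proj2 i (F (p.1, t)))^`() p.2.

Definition non_hyperbolic {R : realType} (F : R * R -> R * R) (p : R * R) :
    Prop :=
  exists2 z : R[i],
    eigenvalue (map_mx (real_complex R) (jacobian2 F p)) z & `|z| = 1.

Definition smaller_eigenvalue {R : realType} (J : 'M[R]_2) (a : R) : Prop :=
  eigenvalue J a /\ exists2 b, eigenvalue J b & `|a| < `|b|.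

(* [eigenspace] consists of row vectors u with u *m g = a *: u; the transpose
   turns these into the column eigenvectors of J. *)
Definition eigenspace2 {R : realType} (J : 'M[R]_2) (a : R) : set (R * R) :=
  [set v | (\row_i proj2 i v <= eigenspace J^T a)%MS].

(* The distance from q to the affine space p + E is o(|q - p|) as q tends to p
   along C. *)
Definition tangential {R : realType} (C : set (R * R)) (p : R * R)
    (E : set (R * R)) : Prop :=
  forall e : R, 0 < e -> \forall q \near within C p^',
    exists2 v, E v & `|q - p - v| <= e * `|q - p|.

Definition graph_on {R : realType} (I : set R) (f : R -> R) : set (R * R) :=
  [set (t, f t) | t in I].

(* Limit points of the graph of f over I at those boundary points of the
   interval I that are finite, whether or not they belong to I. For monotone f
   the absence of a limit there means that the graph escapes to infinity. *)
Definition graph_endpoint {R : realType} (I : set R) (f : R -> R)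
    (e : R * R) : Prop :=
  exists2 a, (closure I `\` I^°) a & (t, f t) @[t --> within I (nbhs a)] --> e.

Definition Wminus {R : realType} (C : set (R * R)) : set (R * R) :=
  [set p | (quadrant `\` C) p /\ exists2 q, C q & le_se p q].

Definition Wplus {R : realType} (C : set (R * R)) : set (R * R) :=
  [set p | (quadrant `\` C) p /\ exists2 q, C q & le_se q p].

Definition separates {R : realType} (C A B : set (R * R)) : Prop :=
  [/\ quadrant `\` C = A `|` B, separated A B, A !=set0 & B !=set0].

(* Main.v *)
(* In the south-east order T is competitive, and T(u) <= T(v) componentwise
   forces u <= v componentwise; hence both coordinates of every orbit are
   eventually monotone, and every orbit converges to one of the two equilibria.
   The basin of p1 is open in the quadrant and, if say p1 lies south-east of p2,
   it is closed under moving to the south-east. The curve C is its relative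
   boundary: strong monotonicity of T^2 leaves no horizontal or vertical segment
   on C, so C is the graph of a continuous increasing function. That p2 lies on
   C follows from the sign of the drift along the nullcline arc from p1 to p2.

   At p2 the Jacobian has eigenvalues mu < 1 and 1, and the eigenvector of 1
   points strictly into the second and fourth quadrants. An orbit near p2 which
   never enters their interiors must therefore stay close to the mu-eigenspace,
   which gives the tangency of C. It then converges at the rate mu, whereas the
   difference of two ordered orbits cannot decay faster than any rate below 1;
   so an orbit converging to p2 from outside C does enter one of them. *)

Require Import Defs.
From mathcomp Require Import ring lra.

Set Implicit Arguments.
Unset Strict Implicit.
Unset Printing Implicit Defensive.

Local Open Scope ring_scope.
Local Open Scope classical_set_scope.

(** * Order-separating curves in the quadrant *)

Section plane.
Context {R : realType}.
Implicit Types (p q u v w : R * R) (A B C : set (R * R)).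

Lemma le_se_refl u : le_se u u.
Proof. by split. Qed.

Lemma le_se_trans u v w : le_se u v -> le_se v w -> le_se u w.
Proof.
move=> [h1 h2] [h3 h4].
by split; [exact: le_trans h1 h3 | exact: le_trans h4 h2].
Qed.

Lemma le_se_anti u v : le_se u v -> le_se v u -> u = v.
Proof.
case: u v => [u1 u2] [v1 v2] [/= h1 h2] [/= h3 h4].
by congr (_, _); apply/eqP; rewrite eq_le; apply/andP.
Qed.

Lemma quadrant_le_se_fst u v : quadrant u -> le_se u v -> 0 <= v.1.
Proof. by move=> [u1 _] [uv _]; exact: le_trans u1 uv. Qed.

Lemma near_fst p (P : set R) : nbhs p.1 P -> \forall q \near p, P q.1.
Proof. by move=> nP; apply: (@cvg_fst _ _ (nbhs p.1) (nbhs p.2) _ P nP). Qed.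

Lemma near_snd p (P : set R) : nbhs p.2 P -> \forall q \near p, P q.2.
Proof. by move=> nP; apply: (@cvg_snd _ _ (nbhs p.1) (nbhs p.2) _ P nP). Qed.

Lemma closed_quadrant : closed (@quadrant R).
Proof.
have -> : @quadrant R = (fst @^-1` [set x | 0 <= x]) `&` (snd @^-1` [set x | 0 <= x]).
  by apply/seteqP; split.
apply: closedI; apply: closed_comp => [p _|]; try exact: closed_ge.
  exact: cvg_fst.
exact: cvg_snd.
Qed.

Lemma quadrant_interior_gt0 p : (@quadrant R)^° p -> 0 < p.1 /\ 0 < p.2.
Proof.
move=> /nbhs_ballP[e /= e0 sub].
have : quadrant (p.1 - e / 2, p.2 - e / 2).
  apply: sub; split; rewrite /ball /= opprB addrC subrK ger0_norm; lra.
by move=> [/= h1 h2]; split; lra.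
Qed.

Lemma interior_Q2 p q : q.1 < p.1 -> p.2 < q.2 -> (Q2 p)^° q.
Proof.
move=> /lt_nbhsl/near_fst n1 /lt_nbhsr/near_snd n2.
by apply: filterS2 n1 n2 => r /ltW r1 /ltW r2; split.
Qed.

Lemma interior_Q4 p q : p.1 < q.1 -> q.2 < p.2 -> (Q4 p)^° q.
Proof.
move=> /lt_nbhsr/near_fst n1 /lt_nbhsl/near_snd n2.
by apply: filterS2 n1 n2 => r /ltW r1 /ltW r2; split.
Qed.

Definition seg u v : set (R * R) :=
  (fun t : R => (u.1 + t * (v.1 - u.1), u.2 + t * (v.2 - u.2))) @` `[0, 1].

Lemma seg_connected u v : connected (seg u v).
Proof.
apply: connected_continuous_connected; first exact: segment_connected.
apply: continuous_subspaceT => t.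
have c (a b : R) : (fun t => a + t * (b - a)) x @[x --> t] --> a + t * (b - a).
  by apply: cvgD; [exact: cvg_cst | apply: cvgM; [exact: cvg_id | exact: cvg_cst]].
exact: cvg_pair (c _ _) (c _ _).
Qed.

Lemma segl u v : seg u v u.
Proof.
exists 0; first by rewrite /= in_itv /= lexx ler01.
by rewrite !mul0r !addr0 -surjective_pairing.
Qed.

Lemma segr u v : seg u v v.
Proof.
exists 1; first by rewrite /= in_itv /= lexx ler01.
by case: v => v1 v2 /=; rewrite !mul1r !subrKC.
Qed.

Lemma seg_le_se u v w : le_se u v -> seg u v w -> le_se u w /\ le_se w v.
Proof.
move=> [h1 h2] [t /=]; rewrite in_itv /= => /andP[t0 t1] <-.
by split; split => /=; nra.
Qed.

End plane.

(* [A] and [B] stand for the parts of the quadrant on the north-west and on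
   the south-east side of [C]. *)
Record se_cut {R : realType} (A B C : set (R * R)) : Prop := SeCut {
  cutA : A `<=` quadrant;
  cutB : B `<=` quadrant;
  cutC : C `<=` quadrant;
  cut_cover : quadrant `<=` A `|` B `|` C;
  cut_AB : forall v, A v -> B v -> False;
  cut_AC : forall v, A v -> C v -> False;
  cut_BC : forall v, B v -> C v -> False;
  cut_openA : forall v, A v -> \forall u \near v, quadrant u -> A u;
  cut_openB : forall v, B v -> \forall u \near v, quadrant u -> B u;
  cut_downA : forall u v, A v \/ C v -> quadrant u -> le_se u v -> u <> v -> A u;
  cut_upB : forall u v, B u \/ C u -> quadrant v -> le_se u v -> u <> v -> B v }.

(** * Topology of a cut and of its curve *)

Section curve.
Context {R : realType} (A B C : set (R * R)) (cut : se_cut A B C).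
Implicit Types (p q u v w : R * R).

(** Both sides are relatively open in the quadrant and disjoint, so neither meets the closure of the
    other. *)
Lemma cut_separated : separated A B.
Proof.
split; apply/seteqP; split => v //= [].
  move=> clA Bv; have [u [Au Bu]] := clA _ (cut_openB cut Bv).
  exact: (cut_AB cut Au (Bu (cutA cut Au))).
move=> Av clB; have [u [Bu Au]] := clB _ (cut_openA cut Av).
exact: (cut_AB cut (Au (cutB cut Bu)) Bu).
Qed.

Lemma cut_closed : closed C.
Proof.
move=> e clC.
have Qe : quadrant e by apply: closed_quadrant; exact: closure_subset (cutC cut) _ clC.
have [[Ae|Be]|//] := cut_cover cut Qe.
  have [u [Cu Au]] := clC _ (cut_openA cut Ae).
  by case: (cut_AC cut (Au (cutC cut Cu)) Cu).
have [u [Cu Bu]] := clC _ (cut_openB cut Be).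
by case: (cut_BC cut (Bu (cutC cut Cu)) Cu).
Qed.

(** A point strictly below a point of [C] belongs to [A], which misses [C]. This antichain property
    makes the curve single-valued and increasing. *)
Lemma cut_le_se_eq u v : C u -> C v -> le_se u v -> u = v.
Proof.
move=> Cu Cv uv; apply: contrapT => neq.
exact: (cut_AC cut (cut_downA cut (or_intror Cv) (cutC cut Cu) uv neq) Cu).
Qed.

Lemma cut_lt u v : C u -> C v -> u.1 < v.1 -> u.2 < v.2.
Proof.
move=> Cu Cv uv; rewrite ltNge; apply/negP => vu.
by move: (uv); rewrite (cut_le_se_eq Cu Cv) ?ltxx//; split => //; exact: (ltW uv).
Qed.

Lemma cut_fst_inj u v : C u -> C v -> u.1 = v.1 -> u = v.
Proof.
move=> Cu Cv uv; case/orP: (le_total u.2 v.2) => h.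
  by apply/esym/cut_le_se_eq => //; split; rewrite ?uv.
by apply: cut_le_se_eq => //; split; rewrite ?uv.
Qed.

(** Otherwise the segment from [u] to [v] would be a connected subset of the separated union of [A]
    and [B] meeting both. *)
Lemma cut_cross u v : A u -> B v -> le_se u v ->
  exists w, [/\ C w, le_se u w & le_se w v].
Proof.
move=> Au Bv uv; apply: contrapT => noC.
have segQ w : seg u v w -> quadrant w.
  move=> /(seg_le_se uv)[[h1 h2] [h3 h4]].
  have [u1 _] := cutA cut Au; have [_ v2] := cutB cut Bv.
  by split; [exact: le_trans u1 h1 | exact: le_trans v2 h4].
have sub : seg u v `<=` A `|` B.
  move=> w sw; have [//|Cw] := cut_cover cut (segQ _ sw).
  by case: noC; exists w; have [] := seg_le_se uv sw.
have [sA|sB] := connected_subset cut_separated sub (@seg_connected _ u v).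
  exact: (cut_AB cut (sA _ (segr _ _)) Bv).
exact: (cut_AB cut Au (sB _ (segl _ _))).
Qed.

Section with_point.
Context (p : R * R) (Cp : C p).

Lemma cut_Wminus : Wminus C = A.
Proof.
apply/seteqP; split => [v [[Qv nCv] [q Cq vq]]|v Av].
  by apply: (cut_downA cut (or_intror Cq) Qv vq) => vq'; apply: nCv; rewrite vq'.
have Qv := cutA cut Av.
split; first by split => // Cv; exact: (cut_AC cut Av Cv).
(* The join of [v] and [p] in the south-east order: unless it is [p] itself it lies in [B], so the
   way up to it from [v] crosses [C]. *)
pose u := (Num.max v.1 p.1, Num.min v.2 p.2).
have vu : le_se v u by split; rewrite /= ?le_max ?ge_min ?lexx.
have pu : le_se p u by split; rewrite /= ?le_max ?ge_min ?lexx ?orbT.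
have [up|up] := pselect (p = u); first by exists p => //; move: vu; rewrite -up.
have Qu : quadrant u.
  have [v1 v2] := Qv; have [p1 p2] := cutC cut Cp.
  by split; rewrite /= ?le_max ?le_min ?v1 ?v2 ?p2.
have [w [Cw vw _]] := cut_cross Av (cut_upB cut (or_intror Cp) Qu pu up) vu.
by exists w.
Qed.

Lemma cut_Wplus : Wplus C = B.
Proof.
apply/seteqP; split => [v [[Qv nCv] [q Cq qv]]|v Bv].
  by apply: (cut_upB cut (or_intror Cq) Qv qv) => vq'; apply: nCv; rewrite -vq'.
have Qv := cutB cut Bv.
split; first by split => // Cv; exact: (cut_BC cut Bv Cv).
pose u := (Num.min v.1 p.1, Num.max v.2 p.2).
have uv : le_se u v by split; rewrite /= ?le_max ?ge_min ?lexx.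
have up : le_se u p by split; rewrite /= ?le_max ?ge_min ?lexx ?orbT.
have [e|ne] := pselect (u = p); first by exists p => //; move: uv; rewrite e.
have Qu : quadrant u.
  have [v1 v2] := Qv; have [p1 p2] := cutC cut Cp.
  by split; rewrite /= ?le_max ?le_min ?v1 ?v2 ?p1.
have [w [Cw _ wv]] := cut_cross (cut_downA cut (or_intror Cp) Qu up ne) Bv uv.
by exists w.
Qed.

Lemma cut_nonemptyA : A (p.1, p.2 + 1).
Proof.
have [p1 p2] := cutC cut Cp.
apply: (cut_downA cut (or_intror Cp)); first by split => //=; lra.
  by split => //=; lra.
by move=> e; have := congr1 snd e => /=; lra.
Qed.

Lemma cut_nonemptyB : B (p.1 + 1, p.2).
Proof.
have [p1 p2] := cutC cut Cp.
apply: (cut_upB cut (or_intror Cp)); first by split => //=; lra.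
  by split => //=; lra.
by move=> e; have := congr1 fst e => /=; lra.
Qed.

Lemma cut_separates : separates C (Wminus C) (Wplus C).
Proof.
rewrite cut_Wminus cut_Wplus; split.
- apply/seteqP; split => [v [Qv nC]|v [Av|Bv]].
  + by case: (cut_cover cut Qv).
  + by split; [exact: (cutA cut Av)| exact: (cut_AC cut Av)].
  + by split; [exact: (cutB cut Bv)| exact: (cut_BC cut Bv)].
- exact: cut_separated.
- by exists (p.1, p.2 + 1); exact: cut_nonemptyA.
- by exists (p.1 + 1, p.2); exact: cut_nonemptyB.
Qed.

End with_point.

(** Each point is tied to [a] by two segments inside [S] with a common end, so [S] is the connected
    component of [a]. *)
Lemma connected_star (S : set (R * R)) a :
  (forall v, S v -> exists m, [/\ seg m v `<=` S & seg m a `<=` S]) ->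
  connected S.
Proof.
move=> H.
have [->|/set0P[b Sb]] := eqVneq S set0; first exact: connected0.
have Sa : S a by have [m [_ sa]] := H b Sb; apply: sa; exact: segr.
suff -> : S = connected_component S a by exact: component_connected.
apply/seteqP; split => v; last by move=> [D [_ DS _] Dv]; exact: DS.
move=> Sv; have [m [sv sa]] := H v Sv.
exists (seg m v `|` seg m a); last by left; exact: segr.
split; [by right; exact: segr | by move=> w [/sv|/sa] |].
by apply: connectedU; [exists m; split; exact: segl | exact: seg_connected..].
Qed.

(** [A] is closed under moving north-west in the quadrant, so two of its points are joined through
    their meet in the south-east order. *)
Lemma cut_connectedA : connected A.
Proof.
have [->|/set0P[a Aa]] := eqVneq A set0; first exact: connected0.
have down u v : A v -> quadrant u -> le_se u v -> A u.
  move=> Av Qu uv; have [->//|] := pselect (u = v).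
  exact: (cut_downA cut (or_introl Av) Qu uv).
have segA m v : le_se m v -> A v -> quadrant m -> seg m v `<=` A.
  move=> mv Av Qm w /(seg_le_se mv)[mw wv]; apply: (down _ v) => //.
  split; first exact: quadrant_le_se_fst Qm mw.
  by have [_ v2] := cutA cut Av; exact: le_trans v2 wv.2.
apply: (@connected_star _ a) => v Av.
have [a1 a2] := cutA cut Aa; have [v1 v2] := cutA cut Av.
have Qm : quadrant (Num.min v.1 a.1, Num.max v.2 a.2).
  by split; rewrite /= ?le_min ?le_max ?v1 ?v2.
exists (Num.min v.1 a.1, Num.max v.2 a.2); split; apply: segA => //;
  by split; rewrite /= ?le_max ?ge_min ?lexx ?orbT.
Qed.

Lemma seg_sym u v : seg u v `<=` seg v u.
Proof.
move=> w [t /=]; rewrite in_itv /= => /andP[t0 t1] <-.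
exists (1 - t); first by rewrite /= in_itv /=; apply/andP; split; lra.
by congr (_, _); ring.
Qed.

Lemma cut_connectedB : connected B.
Proof.
have [->|/set0P[a Ba]] := eqVneq B set0; first exact: connected0.
have up u v : B u -> quadrant v -> le_se u v -> B v.
  move=> Bu Qv uv; have [<-//|] := pselect (u = v).
  exact: (cut_upB cut (or_introl Bu) Qv uv).
have segB m v : le_se v m -> B v -> quadrant m -> seg m v `<=` B.
  move=> vm Bv Qm w /seg_sym/(seg_le_se vm)[vw wm]; apply: (up v) => //.
  split; first exact: quadrant_le_se_fst (cutB cut Bv) vw.
  by case: Qm => _ m2; exact: le_trans m2 wm.2.
apply: (@connected_star _ a) => v Bv.
have [a1 a2] := cutB cut Ba; have [v1 v2] := cutB cut Bv.
have Qm : quadrant (Num.max v.1 a.1, Num.min v.2 a.2).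
  by split; rewrite /= ?le_min ?le_max ?v1 ?v2.
exists (Num.max v.1 a.1, Num.min v.2 a.2); split; apply: segB => //;
  by split; rewrite /= ?le_max ?ge_min ?lexx ?orbT.
Qed.

(** The abscissas of [C] and the function having [C] as graph; off [dom] the value 0 is a
    placeholder. *)
Let dom : set R := [set t | exists y, C (t, y)].
Let height (t : R) : R := xget 0 [set y | C (t, y)].

Let heightP t : dom t -> C (t, height t).
Proof. by move=> [y Cy]; exact: (@xgetPex _ 0 [set y | C (t, y)] (ex_intro _ y Cy)). Qed.

Let height_eq t y : C (t, y) -> height t = y.
Proof.
move=> Cy; have Ch := heightP (ex_intro _ y Cy).
by have [] := cut_fst_inj Ch Cy erefl.
Qed.

(** Over an intermediate abscissa, the point at the height of the right end lies in [A] and the one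
    at the height of the left end in [B]; the vertical segment between them crosses [C]. *)
Let dom_interval : is_interval dom.
Proof.
move=> s t ds dt r /andP[sr rt].
have [->//|nsr] := eqVneq r s; have [->//|nrt] := eqVneq r t.
have {}sr : s < r by rewrite lt_neqAle eq_sym nsr.
have {}rt : r < t by rewrite lt_neqAle nrt.
have Cs := heightP ds; have Ct := heightP dt.
have [s1 s2] := cutC cut Cs; have [t1 t2] := cutC cut Ct.
have st := cut_lt Cs Ct (lt_trans sr rt).
rewrite /= in s1 s2 t1 t2 st.
have Au : A (r, height t).
  apply: (cut_downA cut (or_intror Ct)); first by split => //=; lra.
    by split => //=; lra.
  by case=> e; move: rt; rewrite e ltxx.
have Bu : B (r, height s).
  apply: (cut_upB cut (or_intror Cs)); first by split => //=; lra.
    by split => //=; lra.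
  by case=> e; move: sr; rewrite e ltxx.
have [w [Cw [/= h1 h2] [/= h3 h4]]] : exists w, [/\ C w, le_se (r, height t) w & le_se w (r, height s)].
  by apply: cut_cross => //; split => //=; exact: ltW.
exists w.2; have <- : w.1 = r by apply/eqP; rewrite eq_le h1 h3.
by rewrite -surjective_pairing.
Qed.

(** Points slightly above [(a, y)] lie in [A] and points slightly below in [B], also over nearby
    abscissas by openness, so vertical segments cross [C]. To the left of a point on the horizontal
    axis an increasing curve would leave the quadrant, hence the side condition. *)
Let extend (a y eta : R) : C (a, y) -> 0 < eta ->
  \forall t \near a, 0 <= t -> (0 < y \/ a <= t) ->
    exists2 y', C (t, y') & `|y' - y| <= eta.
Proof.
move=> Cay eta0; have [/= a0 y0] := cutC cut Cay.
have cross (t z1 z2 : R) : 0 <= t -> z1 <= z2 -> A (t, z2) -> B (t, z1) ->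
    exists2 y', C (t, y') & z1 <= y' <= z2.
  move=> t0 z12 A2 B1.
  have [w [Cw [/= h1 h2] [/= h3 h4]]] :=
    cut_cross A2 B1 (conj (lexx t) z12).
  exists w.2; last by rewrite h4.
  have <- : w.1 = t by apply/eqP; rewrite eq_le h1 h3.
  by rewrite -surjective_pairing.
have vert (x z : R) : (t, x) @[t --> z] --> (z, x).
  have ct : (fun _ : R => x) @ z --> x by exact: cvg_cst.
  have id_t : t @[t --> z] --> z by exact: cvg_id.
  exact: cvg_pair id_t ct.
have nearA : \forall t \near a, 0 <= t -> A (t, y + eta).
  have Aa : A (a, y + eta).
    apply: (cut_downA cut (or_intror Cay)); first by split => //=; lra.
      by split => //=; lra.
    by case; lra.
  have Hn : \forall t \near a, quadrant (t, y + eta) -> A (t, y + eta).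
    exact: vert (cut_openA cut Aa).
  apply: filterS Hn => t H t0.
  by apply: H; split => //=; lra.
have nearB : \forall t \near a, 0 <= t -> 0 < y -> B (t, y - Num.min eta y).
  have [y_gt0|y_le0] := ltP 0 y; last by apply: filterE => t _; lra.
  have m1 : 0 < Num.min eta y by rewrite lt_min eta0.
  have m2 : Num.min eta y <= y by rewrite ge_min lexx orbT.
  have Ba : B (a, y - Num.min eta y).
    apply: (cut_upB cut (or_intror Cay)); first by split => //=; lra.
      by split => //=; lra.
    by case; lra.
  have Hn : \forall t \near a, quadrant (t, y - Num.min eta y) -> B (t, y - Num.min eta y).
    exact: vert (cut_openB cut Ba).
  by apply: filterS Hn => t H t0 _; apply: H; split => //=; lra.
apply: filterS2 nearA nearB => t HA HB t0 side.
have [tsa|ta|->] := ltgtP t a; last by exists y; rewrite // subrr normr0 ltW.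
- have ypos : 0 < y by case: side => //; rewrite leNgt tsa.
  have m1 : 0 < Num.min eta y by rewrite lt_min eta0.
  have m2 : Num.min eta y <= eta by rewrite ge_min lexx.
  have At : A (t, y).
    apply: (cut_downA cut (or_intror Cay)) => //.
      by split => //=; exact: ltW.
    by case=> e; move: tsa; rewrite e ltxx.
  have m3 : y - Num.min eta y <= y by lra.
  have [y' Cy' /andP[h1 h2]] := cross _ _ _ t0 m3 At (HB t0 ypos).
  by exists y'; rewrite // ler_norml; apply/andP; split; lra.
- have Bt : B (t, y).
    apply: (cut_upB cut (or_intror Cay)) => //.
      by split => //=; exact: ltW.
    by case=> e; move: ta; rewrite e ltxx.
  have m3 : y <= y + eta by lra.
  have [y' Cy' /andP[h1 h2]] := cross _ _ _ t0 m3 (HA t0) Bt.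
  by exists y'; rewrite // ler_norml; apply/andP; split; lra.
Qed.

Lemma cut_graph : exists (I : set R) (f : R -> R),
  [/\ is_interval I, {within I, continuous f},
      (forall s t, I s -> I t -> s < t -> f s < f t),
      C = graph_on I f &
      forall e, graph_endpoint I f e ->
        (closure (quadrant) `\` (quadrant)^°) e].
Proof.
exists dom, height; split => //.
- apply/subspace_continuousP => a da.
  apply/cvgrPdist_le => e e0.
  have Ca := heightP da.
  rewrite near_withinE; apply: filterS (extend Ca e0) => t H dt.
  have Ct := heightP dt; have [/= t0 ht0] := cutC cut Ct.
  (* The point supplied by [extend] is the graph point over [t]. To the left of [a] its side
     condition holds because the height at [a] exceeds the nonnegative height at [t]. *)
  have [] := H t0; last by move=> y' Cy'; rewrite -(height_eq Cy') distrC.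
  have [ta|] := ltP t a; last by right.
  by left; exact: le_lt_trans ht0 (cut_lt Ct Ca ta).
- by move=> s t ds dt; exact: (cut_lt (heightP ds) (heightP dt)).
- apply/seteqP; split => [[x y] Cxy|_ [t dt <-]]; last exact: heightP.
  by exists x; [exists y | rewrite (height_eq Cxy)].
- move=> e [a [cla na] lim].
  have PF := within_nbhs_proper cla.
  (* The endpoint lies on the closed set [C] over [a]; were it interior to the quadrant, [extend]
     would put a neighbourhood of [a] into [dom]. *)
  have Ce : C e.
    apply: (closed_cvg C cut_closed _ e lim).
    by rewrite near_withinE; apply: filterE => t dt; exact: (heightP dt).
  have ea : e.1 = a.
    have l1 : fst (t, height t) @[t --> within dom (nbhs a)] --> e.1.
      by apply: (cvg_comp _ _ lim); exact: cvg_fst.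
    have l2 : t @[t --> within dom (nbhs a)] --> a by exact: cvg_within.
    exact: (cvg_unique _ l1 l2).
  case: e Ce ea {lim} => e1 e2 /= Ce ea; rewrite {e1}ea in Ce *.
  split; first by apply: subset_closure; exact: (cutC cut Ce).
  move=> /quadrant_interior_gt0[/= a0 y0]; apply: na.
  apply: filterS2 (lt_nbhsr a0) (extend Ce ltr01) => t t0 H.
  by have [|y Cy _] := H (ltW t0); [left | exists y].
Qed.
End curve.

(** * Competitive dynamics *)

Section real_sequences.
Context {R : realType}.

Lemma eventually_monotone_cvg (u : R^nat) (l m : R) N :
  (forall n, l <= u n <= m) ->
  (forall n, (N <= n)%N -> u n <= u n.+1) \/
  (forall n, (N <= n)%N -> u n.+1 <= u n) -> cvgn u.
Proof.
move=> bd mono; apply/cvg_ex.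
have /cvg_ex[l' Hl'] : cvgn (fun n => u (n + N)%N).
  case: mono => mono.
    apply: nondecreasing_is_cvgn.
      by apply/nondecreasing_seqP => n; rewrite /= addSn; apply: mono; exact: leq_addl.
    by exists m => _ [n _ <-]; case/andP: (bd (n + N)%N).
  apply: nonincreasing_is_cvgn.
    by apply/nonincreasing_seqP => n; rewrite /= addSn; apply: mono; exact: leq_addl.
  by exists l => _ [n _ <-]; case/andP: (bd (n + N)%N).
by exists l'; rewrite -(cvg_shiftn N).
Qed.

Lemma cvgn_shift (V : topologicalType) N (u : nat -> V) (l : V) :
  u (n + N)%N @[n --> \oo] --> l <-> u n @[n --> \oo] --> l.
Proof.
split=> lim P nP; have [K _ HK] := lim _ nP.
  exists (K + N)%N => // m /= Km; rewrite -(subnK (leq_trans (leq_addl K N) Km)).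
  by apply: HK => /=; rewrite leq_subRL ?(leq_trans (leq_addl K N))// addnC.
by exists K => // m /= Km; apply: HK => /=; exact: leq_trans (leq_addr _ _).
Qed.

(** After division by [theta ^+ k] the right side is a multiple of a power of [nu / theta] and tends
    to 0. *)
Lemma geometric_gap (nu theta d s : R) : 0 <= nu -> nu < theta -> 0 < d ->
  ~ (forall k, d * theta ^+ k <= s * nu ^+ k).
Proof.
move=> nu0 nut d0 H.
have t0 : 0 < theta by exact: le_lt_trans nut.
have lim : s * (nu / theta) ^+ k @[k --> \oo] --> s * 0.
  apply: cvgM; first exact: cvg_cst.
  by apply: cvg_expr; rewrite ger0_norm ?ltr_pdivrMr ?mul1r// divr_ge0// ltW.
rewrite mulr0 in lim.
have [k _ /(_ k (leqnn k)) /=] := cvgr_lt _ lim _ d0.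
rewrite expr_div_n mulrA ltr_pdivrMr ?exprn_gt0// => dk.
by have := lt_le_trans dk (H k); rewrite ltxx.
Qed.

Lemma le_se_lim (x y : (R * R)^nat) (l m : R * R) : (forall n, le_se (x n) (y n)) ->
  x @ \oo --> l -> y @ \oo --> m -> le_se l m.
Proof.
move=> xy xl ym.
have f (z : (R * R)^nat) (k : R * R) : z @ \oo --> k -> (z n).1 @[n --> \oo] --> k.1.
  by move=> zk P nP; exact (zk _ (near_fst nP)).
have g (z : (R * R)^nat) (k : R * R) : z @ \oo --> k -> (z n).2 @[n --> \oo] --> k.2.
  by move=> zk P nP; exact (zk _ (near_snd nP)).
split.
  apply: (ler_cvg_to (f _ _ xl) (f _ _ ym)).
  by apply: filterE => n; exact: (xy n).1.
apply: (ler_cvg_to (g _ _ ym) (g _ _ xl)).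
by apply: filterE => n; exact: (xy n).2.
Qed.

End real_sequences.

(** * One coordinate of the map *)

Section response.
Context {R : realType} (b c h : R) (b0 : 0 < b) (c0 : 0 < c).

(** Both coordinates of the map have this shape, [x] being the coordinate updated and [y] its
    competitor; the second one swaps the arguments. *)
Definition response (x y : R) : R := b * x / (1 + x + c * y) + h.

Lemma response_den_gt0 x y : 0 <= x -> 0 <= y -> 0 < 1 + x + c * y.
Proof. by move=> x0 y0; have := mulr_ge0 (ltW c0) y0; lra. Qed.

(** Secant slopes make the increment formula exact; on the diagonal they are the partial
    derivatives, up to sign for [slope_y]. *)
Definition slope_x (x y x' y' : R) :=
  b * (1 + c * y) / ((1 + x + c * y) * (1 + x' + c * y')).

Definition slope_y (x y x' y' : R) :=
  b * (c * x) / ((1 + x + c * y) * (1 + x' + c * y')).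

Lemma response_sub x y x' y' : 0 <= x -> 0 <= y -> 0 <= x' -> 0 <= y' ->
  response x' y' - response x y =
  slope_x x y x' y' * (x' - x) - slope_y x y x' y' * (y' - y).
Proof.
move=> x0 y0 x0' y0'.
have d1 := response_den_gt0 x0 y0; have d2 := response_den_gt0 x0' y0'.
by rewrite /response /slope_x /slope_y; field; rewrite !gt_eqF.
Qed.

(** The positive denominators cancel, leaving a linear inequality in the increments with
    coefficients taken at the first point alone. *)
Lemma response_cmp x y x' y' : 0 <= x -> 0 <= y -> 0 <= x' -> 0 <= y' ->
  (response x y <= response x' y') = (c * x * (y' - y) <= (1 + c * y) * (x' - x)) /\
  (response x y < response x' y') = (c * x * (y' - y) < (1 + c * y) * (x' - x)).
Proof.
move=> x0 y0 x0' y0'.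
have d1 := response_den_gt0 x0 y0; have d2 := response_den_gt0 x0' y0'.
rewrite -subr_ge0 -subr_gt0 response_sub// /slope_x /slope_y.
rewrite (_ : _ - _ = b / ((1 + x + c * y) * (1 + x' + c * y')) *
  ((1 + c * y) * (x' - x) - c * x * (y' - y))); last by ring.
have k0 : 0 < b / ((1 + x + c * y) * (1 + x' + c * y')).
  by rewrite divr_gt0 ?mulr_gt0.
by rewrite pmulr_rge0// pmulr_rgt0// subr_ge0 subr_gt0.
Qed.

Lemma response_bounds x y : 0 <= x -> 0 <= y -> h <= response x y <= b + h.
Proof.
move=> x0 y0; have d1 := response_den_gt0 x0 y0.
have bx : 0 <= b * x / (1 + x + c * y).
  by rewrite divr_ge0 ?mulr_ge0// ltW.
rewrite /response lerDr lerD2r bx/= ler_pdivrMr// ler_pM2l//.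
by have := mulr_ge0 (ltW c0) y0; lra.
Qed.

Lemma response_homo x y x' y' : 0 <= x -> 0 <= y -> 0 <= x' -> 0 <= y' ->
  x <= x' -> y' <= y -> response x y <= response x' y'.
Proof.
move=> x0 y0 x0' y0' xx yy; rewrite (response_cmp x0 y0 x0' y0').1.
apply: (@le_trans _ _ 0).
  by rewrite mulr_ge0_le0 ?subr_le0// mulr_ge0// ltW.
by rewrite mulr_ge0 ?subr_ge0// addr_ge0// mulr_ge0// ltW.
Qed.

(** At [x = 0] the response ignores [y], hence the positivity demanded when the strictness comes
    from [y]. *)
Lemma response_lt x y x' y' : 0 <= x -> 0 <= y -> 0 <= x' -> 0 <= y' ->
  x <= x' -> y' <= y -> x < x' \/ (0 < x /\ y' < y) ->
  response x y < response x' y'.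
Proof.
move=> x0 y0 x0' y0' xx yy H; rewrite (response_cmp x0 y0 x0' y0').2.
have cy : 0 <= c * y by rewrite mulr_ge0// ltW.
case: H => [lt_x|[x_gt0 lt_y]].
  apply: (@le_lt_trans _ _ 0).
    by rewrite mulr_ge0_le0 ?subr_le0// mulr_ge0// ltW.
  by rewrite mulr_gt0 ?subr_gt0//; lra.
apply: (@lt_le_trans _ _ 0).
  by rewrite pmulr_rlt0 ?subr_lt0// mulr_gt0.
by rewrite mulr_ge0 ?subr_ge0// addr_ge0.
Qed.

Lemma response_continuous (p : R * R) : 0 <= p.1 -> 0 <= p.2 ->
  response q.1 q.2 @[q --> p] --> response p.1 p.2.
Proof.
move=> x0 y0; have d := response_den_gt0 x0 y0.
apply: cvgD; last exact: cvg_cst.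
apply: cvgM; first by apply: cvgM; [exact: cvg_cst | exact: cvg_fst].
apply: cvgV; first by rewrite gt_eqF.
apply: cvgD; last by apply: cvgM; [exact: cvg_cst | exact: cvg_snd].
by apply: cvgD; [exact: cvg_cst | exact: cvg_fst].
Qed.

End response.

(** * Global dynamics of the competitive map *)

Section system.
Context {R : realType} (b1 b2 c1 c2 h1 h2 : R)
  (hb1 : 0 < b1) (hb2 : 0 < b2) (hc1 : 0 < c1) (hc2 : 0 < c2)
  (hh1 : 0 < h1) (hh2 : 0 < h2).
Implicit Types (p q u v w z : R * R).

Let T := sysmap b1 b2 c1 c2 h1 h2.

Let T1E q : (T q).1 = response b1 c1 h1 q.1 q.2. Proof. by []. Qed.
Let T2E q : (T q).2 = response b2 c2 h2 q.2 q.1. Proof. by []. Qed.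

Definition se_lt u v := u.1 < v.1 /\ v.2 < u.2.

Lemma sysmap_ge q : quadrant q -> h1 <= (T q).1 /\ h2 <= (T q).2.
Proof.
move=> [q1 q2].
by split; [case/andP: (response_bounds h1 hb1 hc1 q1 q2) |
           case/andP: (response_bounds h2 hb2 hc2 q2 q1)].
Qed.

Lemma sysmap_le q : quadrant q -> (T q).1 <= b1 + h1 /\ (T q).2 <= b2 + h2.
Proof.
move=> [q1 q2].
by split; [case/andP: (response_bounds h1 hb1 hc1 q1 q2) |
           case/andP: (response_bounds h2 hb2 hc2 q2 q1)].
Qed.

Lemma sysmap_quadrant q : quadrant q -> quadrant (T q).
Proof.
by move=> /sysmap_ge[g1 g2]; split; [apply: le_trans g1 | apply: le_trans g2];
  exact: ltW.
Qed.

Lemma iter_quadrant n q : quadrant q -> quadrant (iter n T q).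
Proof. by move=> Qq; elim: n => //= n; exact: sysmap_quadrant. Qed.

Lemma sysmap_continuous q : quadrant q -> T x @[x --> q] --> T q.
Proof.
move=> [q1 q2].
have C1 := @response_continuous _ b1 c1 h1 hc1 q q1 q2.
have C2 := @response_continuous _ b2 c2 h2 hc2 (q.2, q.1) q2 q1.
have sw : (x.2, x.1) @[x --> q] --> (q.2, q.1).
  have s1 : x.1 @[x --> q] --> q.1 by exact: cvg_fst.
  have s2 : x.2 @[x --> q] --> q.2 by exact: cvg_snd.
  exact: cvg_pair s2 s1.
exact: cvg_pair C1 (cvg_comp _ _ sw C2).
Qed.

Lemma iter_continuous n q : quadrant q -> iter n T x @[x --> q] --> iter n T q.
Proof.
move=> Qq; elim: n => [|n IH]; first exact: cvg_id.
exact: (cvg_comp _ _ IH (sysmap_continuous (iter_quadrant n Qq))).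
Qed.

Lemma sysmap_le_se u v : quadrant u -> quadrant v -> le_se u v ->
  le_se (T u) (T v).
Proof.
by move=> [u1 u2] [v1 v2] [uv1 uv2]; split; apply: response_homo.
Qed.

Lemma iter_le_se n u v : quadrant u -> quadrant v -> le_se u v ->
  le_se (iter n T u) (iter n T v).
Proof.
move=> Qu Qv uv; elim: n => //= n; apply: sysmap_le_se; exact: iter_quadrant.
Qed.

Lemma sysmap_se_lt u v : quadrant u -> quadrant v -> se_lt u v ->
  se_lt (T u) (T v).
Proof.
move=> [u1 u2] [v1 v2] [uv1 uv2]; split; apply: response_lt => //;
  by [exact: ltW | left].
Qed.

Lemma iter_se_lt n u v : quadrant u -> quadrant v -> se_lt u v ->
  se_lt (iter n T u) (iter n T v).
Proof.
move=> Qu Qv uv; elim: n => //= n; apply: sysmap_se_lt; exact: iter_quadrant.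
Qed.

(** The hypotheses are linear in the increments, with a matrix of determinant
    [1 + c1 * u.2 + c2 * u.1] whose cofactor combinations have nonnegative weights and isolate each
    increment. *)
Lemma sysmap_oplus u v : quadrant u -> quadrant v ->
  (T u).1 <= (T v).1 -> (T u).2 <= (T v).2 -> u.1 <= v.1 /\ u.2 <= v.2.
Proof.
move=> [u1 u2] [v1 v2].
rewrite !T1E !T2E (response_cmp _ _ hc1 u1 u2 v1 v2).1//.
rewrite (response_cmp _ _ hc2 u2 u1 v2 v1).1// => H1 H2.
have A1 : 0 <= c1 * u.1 by rewrite mulr_ge0// ltW.
have A2 : 0 <= c1 * u.2 by rewrite mulr_ge0// ltW.
have A3 : 0 <= c2 * u.1 by rewrite mulr_ge0// ltW.
have A4 : 0 <= c2 * u.2 by rewrite mulr_ge0// ltW.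
have P : 0 < 1 + c1 * u.2 + c2 * u.1 by lra.
rewrite -subr_ge0 in H1; rewrite -subr_ge0 in H2.
split.
- have : 0 <= (1 + c1 * u.2 + c2 * u.1) * (v.1 - u.1).
    rewrite [leRHS](_ : _ =
      (1 + c2 * u.1) * ((1 + c1 * u.2) * (v.1 - u.1) - c1 * u.1 * (v.2 - u.2)) +
      (c1 * u.1) * ((1 + c2 * u.1) * (v.2 - u.2) - c2 * u.2 * (v.1 - u.1)));
      last by ring.
    by rewrite addr_ge0// mulr_ge0//; lra.
  by rewrite pmulr_rge0// subr_ge0.
- have : 0 <= (1 + c1 * u.2 + c2 * u.1) * (v.2 - u.2).
    rewrite [leRHS](_ : _ =
      (1 + c1 * u.2) * ((1 + c2 * u.1) * (v.2 - u.2) - c2 * u.2 * (v.1 - u.1)) +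
      (c2 * u.2) * ((1 + c1 * u.2) * (v.1 - u.1) - c1 * u.1 * (v.2 - u.2)));
      last by ring.
    by rewrite addr_ge0// mulr_ge0//; lra.
  by rewrite pmulr_rge0// subr_ge0.
Qed.

Lemma sysmap_inj u v : quadrant u -> quadrant v -> T u = T v -> u = v.
Proof.
move=> Qu Qv e.
have [a1 a2] : u.1 <= v.1 /\ u.2 <= v.2 by apply: sysmap_oplus; rewrite ?e.
have [a3 a4] : v.1 <= u.1 /\ v.2 <= u.2 by apply: sysmap_oplus; rewrite ?e.
by apply: le_se_anti; split.
Qed.

(** Where [u.1] and [v.2] are positive, each coordinate responds strictly to its competitor, so a
    difference in one coordinate spreads to both. *)
Lemma sysmap_lt u v : quadrant u -> quadrant v -> 0 < u.1 -> 0 < v.2 ->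
  le_se u v -> u <> v -> se_lt (T u) (T v).
Proof.
move=> [u1 u2] [v1 v2] u0 v0 [uv1 uv2] neq.
have alt : u.1 < v.1 \/ v.2 < u.2.
  have [l1|l1] := ltP u.1 v.1; first by left.
  right; rewrite ltNge; apply/negP => l2; apply: neq.
  by apply: le_se_anti; split.
split; apply: response_lt => //.
  by case: alt => ?; [left | right].
by case: alt => ?; [right | left].
Qed.

(** The first step makes both coordinates positive and keeps the points distinct; the second is then
    strict by [sysmap_lt]. *)
Lemma sysmap2_lt u v : quadrant u -> quadrant v ->
  le_se u v -> u <> v -> se_lt (iter 2 T u) (iter 2 T v).
Proof.
move=> Qu Qv uv neq; apply: sysmap_lt.
- exact: sysmap_quadrant.
- exact: sysmap_quadrant.
- exact: lt_le_trans (sysmap_ge Qu).1.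
- exact: lt_le_trans (sysmap_ge Qv).2.
- exact: sysmap_le_se.
- by move=> /(sysmap_inj Qu Qv).
Qed.

(* A south-east step persists forever; by [sysmap_oplus] a north-east step is
   preceded only by north-east steps. *)
Lemma iter_steps q : quadrant q -> exists N,
  [\/ forall n, (N <= n)%N -> le_se (iter n T q) (iter n.+1 T q),
      forall n, (N <= n)%N -> le_se (iter n.+1 T q) (iter n T q),
      forall n, (N <= n)%N ->
        (iter n T q).1 <= (iter n.+1 T q).1 /\ (iter n T q).2 <= (iter n.+1 T q).2 |
      forall n, (N <= n)%N ->
        (iter n.+1 T q).1 <= (iter n T q).1 /\ (iter n.+1 T q).2 <= (iter n T q).2].
Proof.
move=> Qq; have Qn n := iter_quadrant n Qq.
have fwd (P : R * R -> R * R -> Prop) N :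
    (forall u v, quadrant u -> quadrant v -> P u v -> P (T u) (T v)) ->
    P (iter N T q) (iter N.+1 T q) ->
    forall n, (N <= n)%N -> P (iter n T q) (iter n.+1 T q).
  move=> mono PN n /subnK <-; elim: (n - N)%N => // k IH.
  by rewrite addSn; exact: (mono _ _ (Qn _) (Qn _.+1) IH).
have [[N HN]|no1] := pselect (exists N, le_se (iter N T q) (iter N.+1 T q)).
  exists N; apply: Or41; apply: (fwd le_se) => // u v; exact: sysmap_le_se.
have [[N HN]|no2] := pselect (exists N, le_se (iter N.+1 T q) (iter N T q)).
  exists N; apply: Or42.
  by apply: (fwd (fun u v => le_se v u)) => // u v Qu Qv; exact: sysmap_le_se.
have [[N HN]|no3] := pselect (exists N,
    (iter N.+1 T q).1 <= (iter N T q).1 /\ (iter N.+1 T q).2 <= (iter N T q).2).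
  exists N; apply: Or44 => n /subnK <-; elim: (n - N)%N => // k [g1 g2].
  rewrite addSn; set m := (k + N)%N in g1 g2 *.
  have [l1|l1] := leP (iter m.+1 T q).1 (iter m.+2 T q).1;
    have [l2|l2] := leP (iter m.+1 T q).2 (iter m.+2 T q).2.
  (* A north-east step right after a south-west one forces the latter to be trivial, and a trivial
     step is also a south-east one. *)
  - have [e1 e2] := sysmap_oplus (Qn m) (Qn m.+1) l1 l2.
    by case: no1; exists m; split.
  - by case: no1; exists m.+1; split => //; exact: ltW.
  - by case: no2; exists m.+1; split => //; exact: ltW.
  - by split; exact: ltW.
exists 0%N; apply: Or43 => n _.
have [l1|l1] := leP (iter n T q).1 (iter n.+1 T q).1;
  have [l2|l2] := leP (iter n T q).2 (iter n.+1 T q).2.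
- by split.
- by case: no1; exists n; split => //; exact: ltW.
- by case: no2; exists n; split => //; exact: ltW.
- by case: no3; exists n; split; exact: ltW.
Qed.

(** Eventually monotone bounded coordinates converge, and continuity makes the limit an
    equilibrium. *)
Lemma iter_cvg q : quadrant q ->
  exists2 l, equilibria T l & iter n T q @[n --> \oo] --> l.
Proof.
move=> Qq; have Qn n := iter_quadrant n Qq.
have bd n : 0 <= (iter n T q).1 <= q.1 + (b1 + h1) /\
            0 <= (iter n T q).2 <= q.2 + (b2 + h2).
  have [a1 a2] := Qn n; rewrite a1 a2 /=; have [q1 q2] := Qq.
  case: n {a1 a2} => [|n]; first by rewrite /= !lerDl !addr_ge0// ltW.
  by have [t1 t2] := sysmap_le (Qn n); split; [apply: le_trans t1 _ | apply: le_trans t2 _]; rewrite lerDr.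
have [N HN] := iter_steps Qq.
have /cvg_ex[l1 L1] : cvgn (fun n => (iter n T q).1).
  apply: (@eventually_monotone_cvg _ _ 0 (q.1 + (b1 + h1)) N) => [n|].
    exact: (bd n).1.
  by case: HN => H; [left|right|left|right] => n /H[].
have /cvg_ex[l2 L2] : cvgn (fun n => (iter n T q).2).
  apply: (@eventually_monotone_cvg _ _ 0 (q.2 + (b2 + h2)) N) => [n|].
    exact: (bd n).2.
  by case: HN => H; [right|left|left|right] => n /H[].
have L : iter n T q @[n --> \oo] --> (l1, l2).
  rewrite [X in X @ _ --> _](_ : _ = fun n => ((iter n T q).1, (iter n T q).2)).
    exact: cvg_pair L1 L2.
  by apply/funext => n; rewrite -surjective_pairing.
have Ql : quadrant (l1, l2).
  apply: (closed_cvg _ closed_quadrant _ _ L).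
  by apply: filterE => n; exact: Qn.
exists (l1, l2) => //; split => //.
have LS : iter n.+1 T q @[n --> \oo] --> (l1, l2).
  have := (cvgn_shift 1 (fun n => iter n T q) (l1, l2)).2 L.
  by under eq_fun do rewrite addn1.
have LT : T (iter n T q) @[n --> \oo] --> T (l1, l2).
  exact: (cvg_comp _ _ L (sysmap_continuous Ql)).
exact: (cvg_unique _ LT LS).
Qed.

(** The points whose first coordinate the map fixes, solved for the second coordinate; meaningful
    for [x > h1], where all equilibria lie. *)
Let nullcline (x : R) := (b1 * x / (x - h1) - 1 - x) / c1.

Let nullclineP x : h1 < x -> (T (x, nullcline x)).1 = x.
Proof.
move=> hx; have x0 : 0 < x by exact: lt_trans hx.
have d : 0 < x - h1 by rewrite subr_gt0.
rewrite /nullcline /=.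
rewrite (_ : 1 + x + c1 * _ = b1 * x / (x - h1)); last first.
  by field; rewrite !gt_eqF.
by field; rewrite !gt_eqF.
Qed.

Let nullcline_equilibrium p : equilibria T p -> h1 < p.1 /\ nullcline p.1 = p.2.
Proof.
move=> [[x0 y0] Tp]; have D0 := response_den_gt0 hc1 x0 y0.
have e : b1 * p.1 / (1 + p.1 + c1 * p.2) + h1 = p.1 by exact: (congr1 fst Tp).
have px : 0 < p.1.
  by rewrite -e ltr_wpDl// divr_ge0 ?mulr_ge0// ltW.
have hx : h1 < p.1.
  by rewrite -subr_gt0 -e addrK divr_gt0 ?mulr_gt0.
split => //; rewrite /nullcline.
have -> : p.1 - h1 = b1 * p.1 / (1 + p.1 + c1 * p.2) by apply/eqP; rewrite subr_eq e.
by field; rewrite !gt_eqF.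
Qed.

Let nullcline_decr x x' : h1 < x -> x < x' -> nullcline x' < nullcline x.
Proof.
move=> hx xx; have hx' := lt_trans hx xx.
have d : 0 < x - h1 by rewrite subr_gt0.
have d' : 0 < x' - h1 by rewrite subr_gt0.
rewrite -subr_gt0.
rewrite (_ : _ - _ = (b1 * h1 / ((x - h1) * (x' - h1)) + 1) * (x' - x) / c1).
  rewrite divr_gt0// mulr_gt0 ?subr_gt0// addr_gt0// divr_gt0// mulr_gt0//.
by rewrite /nullcline; field; rewrite !gt_eqF.
Qed.

Let nullcline_continuous x : h1 < x -> nullcline z @[z --> x] --> nullcline x.
Proof.
move=> hx; apply: cvgM; last exact: cvg_cst.
apply: cvgB; last exact: cvg_id.
apply: cvgB; last exact: cvg_cst.
apply: cvgM; first by apply: cvgM; [exact: cvg_cst | exact: cvg_id].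
apply: cvgV; first by rewrite gt_eqF// subr_gt0.
by apply: cvgB; [exact: cvg_id | exact: cvg_cst].
Qed.

(** All equilibria lie on the graph of the decreasing function [nullcline]. *)
Lemma equilibria_comparable p q : equilibria T p -> equilibria T q ->
  le_se p q \/ le_se q p.
Proof.
move=> /nullcline_equilibrium[hp ep] /nullcline_equilibrium[hq eq'].
have [pq|qp|e] := ltgtP p.1 q.1.
- by left; split; [|rewrite -ep -eq']; apply/ltW => //; exact: nullcline_decr.
- by right; split; [|rewrite -ep -eq']; apply/ltW => //; exact: nullcline_decr.
- by left; split; rewrite ?e// -ep -eq' e.
Qed.

(** * The two basins and the boundary between them *)

Section two_equilibria.
Context (p1 p2 : R * R) (p12 : p1 <> p2) (eqT : equilibria T = [set p1; p2]).

Let B1 := basin T p1.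
Let B2 := basin T p2.

Lemma equilibrium_fst : equilibria T p1. Proof. by rewrite eqT; left. Qed.
Lemma equilibrium_snd : equilibria T p2. Proof. by rewrite eqT; right. Qed.

Lemma iter_equilibrium p n : equilibria T p -> iter n T p = p.
Proof. by move=> [_ Tp]; elim: n => //= n ->. Qed.

Lemma equilibrium_basin p : equilibria T p -> basin T p p.
Proof.
move=> ep; split; first by case: ep.
rewrite [X in X @ _ --> _](_ : _ = fun=> p); first exact: cvg_cst.
by apply/funext => n; exact: iter_equilibrium.
Qed.

Lemma basin_cover q : quadrant q -> B1 q \/ B2 q.
Proof.
by move=> Qq; have [l + lim] := iter_cvg Qq; rewrite eqT => -[e|e];
  [left|right]; split => //; rewrite -e.
Qed.

Lemma basin_disjoint q : B1 q -> B2 q -> False.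
Proof. by move=> [_ l1] [_ l2]; apply: p12; exact: (cvg_unique _ l1 l2). Qed.

Lemma basin_iter p n q : quadrant q -> basin T p (iter n T q) <-> basin T p q.
Proof.
move=> Qq.
have e : (fun m => iter m T (iter n T q)) = (fun m => iter (m + n) T q).
  by apply/funext => m; rewrite iterD.
have sh := cvgn_shift n (fun m => iter m T q) p.
split=> -[_ l]; split => //; try exact: iter_quadrant.
  by apply/sh; rewrite -e.
by rewrite e; apply/sh.
Qed.

Hypothesis las : loc_asympt_stable T p1.

(** Some iterate of [v] lies inside a neighbourhood attracted by [p1], and that iterate depends
    continuously on the starting point. *)
Lemma basin_open v : B1 v -> \forall u \near v, quadrant u -> B1 u.
Proof.
move=> [Qv lim]; have [_ [V nV VB]] := las.
have [n _ /(_ n (leqnn n)) Vn] := lim _ (nbhs_interior nV).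
have Hn : \forall u \near v, V (iter n T u) by exact (@iter_continuous n v Qv _ Vn).
apply: filterS Hn => u Vu Qu.
by apply/(basin_iter p1 n Qu); apply: VB; split => //; exact: iter_quadrant.
Qed.

(* The order is oriented so that [p2] lies below [p1]; this treats the two
   possible positions of [p1] at once. *)
Context (s : bool).
Definition le_dir u v := if s then le_se u v else le_se v u.
Definition lt_dir u v := if s then se_lt u v else se_lt v u.
Hypothesis p21 : le_dir p2 p1.

Lemma le_dir_anti u v : le_dir u v -> le_dir v u -> u = v.
Proof. by rewrite /le_dir; case: s => ? ?; [|symmetry]; exact: le_se_anti. Qed.

Lemma le_dir_lim (x y : (R * R)^nat) (l m : R * R) : (forall n, le_dir (x n) (y n)) ->
  x @ \oo --> l -> y @ \oo --> m -> le_dir l m.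
Proof. by rewrite /le_dir; case: s => H xl ym; exact: (le_se_lim H). Qed.

Lemma iter_le_dir n u v : quadrant u -> quadrant v -> le_dir u v ->
  le_dir (iter n T u) (iter n T v).
Proof. by rewrite /le_dir; case: s => Qu Qv; exact: iter_le_se. Qed.

Lemma near_lt_dir u v : lt_dir u v -> \forall w \near u, le_dir w v.
Proof.
rewrite /lt_dir /le_dir; case: s => -[h k].
  apply: filterS2 (near_fst (lt_nbhsl h)) (near_snd (lt_nbhsr k)).
  by move=> w a b; split; exact: ltW.
apply: filterS2 (near_fst (lt_nbhsr h)) (near_snd (lt_nbhsl k)).
by move=> w a b; split; exact: ltW.
Qed.

(** Ordered orbits have ordered limits; were [v] attracted by [p2], [p1] would lie below [p2]. *)
Lemma basin_up u v : B1 u -> quadrant v -> le_dir u v -> B1 v.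
Proof.
move=> [Qu lu] Qv uv; have [//|[_ lv]] := basin_cover Qv.
case: p12; apply: le_dir_anti p21.
exact: (le_dir_lim (fun n => iter_le_dir n Qu Qv uv) lu lv).
Qed.

(** Two steps make the order of [u] and [v] strict, so points of the basin close to [u] are sent
    below the image of [v] and [basin_up] applies. *)
Lemma closure_basin_up u v : quadrant u -> closure B1 u -> quadrant v ->
  le_dir u v -> u <> v -> B1 v.
Proof.
move=> Qu clu Qv uv neq.
have lt2 : lt_dir (iter 2 T u) (iter 2 T v).
  move: uv; rewrite /lt_dir /le_dir; case: s => uv; apply: sysmap2_lt => //.
  by move=> e; apply: neq.
have Hn : \forall w \near u, le_dir (iter 2 T w) (iter 2 T v).
  exact (@iter_continuous 2 u Qu _ (near_lt_dir lt2)).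
have [w [Bw wv]] := clu _ Hn.
have Qw : quadrant w by case: Bw.
apply/(basin_iter p1 2 Qv); apply: basin_up wv; last exact: iter_quadrant.
exact/(basin_iter p1 2 Qw).
Qed.

(** [C] is the boundary of the basin of [p1] relative to the quadrant, and [D] is what remains of
    the basin of [p2]. *)
Let C := B2 `&` closure B1.
Let D := quadrant `\` closure B1.

Lemma basin_se_cut : if s then se_cut D B1 C else se_cut B1 D C.
Proof.
have CQ : C `<=` quadrant by move=> v [[]].
have cover v : quadrant v -> D v \/ B1 v \/ C v.
  move=> Qv; have [Bv|Bv] := basin_cover Qv; first by right; left.
  by have [clv|clv] := pselect (closure B1 v); [right; right | left].
have DB v : D v -> B1 v -> False by move=> [_ nc] /subset_closure.
have DC v : D v -> C v -> False by move=> [_ nc] [].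
have BC v : B1 v -> C v -> False by move=> Bv [/(basin_disjoint Bv)].
have Dopen v : D v -> \forall u \near v, quadrant u -> D u.
  move=> [Qv nc]; have : open (~` closure B1) by rewrite openC; exact: closed_closure.
  by rewrite openE => /(_ v nc); apply: filterS => u.
have Ddown u v : D v \/ C v -> quadrant u -> le_dir u v -> u <> v -> D u.
  move=> DCv Qu uv neq; split => // clu.
  have Qv : quadrant v by case: DCv => [[]|/CQ].
  have Bv := closure_basin_up Qu clu Qv uv neq.
  by case: DCv => [/DB|/(BC _ Bv)]; exact.
have Bup u v : B1 u \/ C u -> quadrant v -> le_dir u v -> u <> v -> B1 v.
  move=> BCu Qv uv neq; have Qu : quadrant u by case: BCu => [[]|/CQ].
  apply: closure_basin_up uv neq => //.
  by case: BCu => [/subset_closure|[]].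
have BQ : B1 `<=` quadrant by move=> v [].
have DQ : D `<=` quadrant by move=> v [].
move: Ddown Bup; rewrite /le_dir; case: s => Ddown Bup; split => //.
- by move=> v /cover[|[]]; [left; left | left; right | right].
- exact: basin_open.
- by move=> v /cover[|[]]; [left; right | left; left | right].
- by move=> v Bv /DB; exact.
- exact: basin_open.
- by move=> u v BCv Qu uv neq; apply: (Bup v u) => // e; apply: neq.
- by move=> u v BCv Qu uv neq; apply: (Ddown v u) => // e; apply: neq.
Qed.

Lemma sysmap_closure_basin v : quadrant v -> closure B1 v -> closure B1 (T v).
Proof.
move=> Qv clv U nU; have [w [Bw Uw]] := clv _ (sysmap_continuous Qv nU).
have Qw : quadrant w by case: Bw.
by exists (T w); split => //; exact/(basin_iter p1 1 Qw).
Qed.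

Lemma boundary_invariant : invariant_set T C.
Proof.
move=> _ [v [B2v clv] <-]; have Qv : quadrant v by case: B2v.
by split; [exact/(basin_iter p2 1 Qv) | exact: sysmap_closure_basin].
Qed.

Lemma basin_invariant : invariant_set T B1.
Proof.
by move=> _ [v Bv <-]; have Qv : quadrant v by [case: Bv]; exact/(basin_iter p1 1 Qv).
Qed.

Lemma basin_repelled v : D v -> B2 v.
Proof. by move=> [Qv nc]; case: (basin_cover Qv) => // /subset_closure. Qed.

Lemma exterior_below v : C p2 -> D v -> exists2 w, C w & le_dir v w /\ v <> w.
Proof.
move=> Cp Dv; have : (if s then Wminus C else Wplus C) v.
  move: basin_se_cut; case: s => cut.
    by rewrite (cut_Wminus cut Cp).
  by rewrite (cut_Wplus cut Cp).
rewrite /le_dir; case: s => -[[Qv nC] [w Cw vw]];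
  by exists w => //; split => // e; apply: nC; rewrite e.
Qed.

(** Were [T v] on [C], it would be comparable with the image of a point of [C] above [v]; the
    antichain property would make the two images equal, against injectivity. *)
Lemma exterior_invariant : C p2 -> invariant_set T D.
Proof.
move=> Cp _ [v Dv <-]; have [w Cw [vw neq]] := exterior_below Cp Dv.
have Qv : quadrant v by case: Dv.
have Qw : quadrant w by case: Cw => -[].
split; first exact: sysmap_quadrant.
move=> clTv; have CTv : C (T v).
  by split => //; apply/(basin_iter p2 1 Qv); exact: basin_repelled.
have CTw : C (T w) by apply: boundary_invariant; exists w.
apply: neq; apply: sysmap_inj => //.
have := iter_le_dir 1 Qv Qw vw; move: basin_se_cut; rewrite /le_dir.
case: s => cut TT; first exact: (cut_le_se_eq cut CTv CTw).
by symmetry; exact: (cut_le_se_eq cut CTw CTv).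
Qed.

Lemma le_dir_trans v u w : le_dir u v -> le_dir v w -> le_dir u w.
Proof. by rewrite /le_dir; case: s => uv vw; apply: le_se_trans; eauto. Qed.

Lemma le_dir_refl u : le_dir u u.
Proof. by rewrite /le_dir; case: s; exact: le_se_refl. Qed.

(** By monotonicity the whole orbit stays above [q], so its limit cannot be [p2]. *)
Lemma subsolution_basin q : quadrant q -> le_dir q (T q) -> le_dir p2 q ->
  q <> p2 -> B1 q.
Proof.
move=> Qq qTq p2q neq; have [//|[_ lim]] := basin_cover Qq.
have up n : le_dir q (iter n T q).
  elim: n => [|n IH]; first exact: le_dir_refl.
  apply: le_dir_trans qTq _.
  exact: (iter_le_dir 1 Qq (iter_quadrant n Qq) IH).
case: neq; apply: le_dir_anti p2q.
exact: (le_dir_lim up (cvg_cst _) lim).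
Qed.

Lemma supersolution_basin q : quadrant q -> le_dir (T q) q -> le_dir q p1 ->
  q <> p1 -> B2 q.
Proof.
move=> Qq qTq qp1 neq; have [[_ lim]|//] := basin_cover Qq.
have down n : le_dir (iter n T q) q.
  elim: n => [|n IH]; first exact: le_dir_refl.
  apply: le_dir_trans _ qTq.
  exact: (iter_le_dir 1 (iter_quadrant n Qq) Qq IH).
case: neq; apply: le_dir_anti => //.
exact: (le_dir_lim down lim (cvg_cst _)).
Qed.

(** The nullcline between the equilibria, parametrised from [p1] at 0 to [p2] at 1. *)
Let arc_fst (t : R) := p1.1 + t * (p2.1 - p1.1).
Let arc (t : R) := (arc_fst t, nullcline (arc_fst t)).

Let arc_fst_gt (t : R) : 0 <= t <= 1 -> h1 < arc_fst t.
Proof.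
move=> /andP[t0 t1]; rewrite /arc_fst.
have [x1 _] := nullcline_equilibrium equilibrium_fst.
have [x2 _] := nullcline_equilibrium equilibrium_snd.
by case/orP: (le_total p1.1 p2.1) => ?; nra.
Qed.

Let arc_continuous (t : R) : 0 <= t <= 1 -> arc z @[z --> t] --> arc t.
Proof.
move=> t01; have fst_cvg : arc_fst z @[z --> t] --> arc_fst t.
  by apply: cvgD; [exact: cvg_cst | apply: cvgM; [exact: cvg_id | exact: cvg_cst]].
exact: (cvg_pair fst_cvg (cvg_comp _ _ fst_cvg (nullcline_continuous (arc_fst_gt t01)))).
Qed.

Let arc_between (t : R) : 0 < t < 1 -> [/\ quadrant (arc t), le_dir p2 (arc t),
  le_dir (arc t) p1, arc t <> p1 & arc t <> p2].
Proof.
move=> /andP[t0 t1].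
have hx : h1 < arc_fst t by apply: arc_fst_gt; rewrite !ltW.
have [x1 y1] := nullcline_equilibrium equilibrium_fst.
have [x2 y2] := nullcline_equilibrium equilibrium_snd.
have [[_ p1y] _] := equilibrium_fst; have [[_ p2y] _] := equilibrium_snd.
have neq : p1.1 <> p2.1.
  move=> e; apply: p12; rewrite [p1]surjective_pairing [p2]surjective_pairing.
  by rewrite -y1 -y2 e.
have ne q : arc_fst t <> q.1 -> arc t <> q by move=> n1 e; apply: n1; rewrite -e.
have key : [/\ 0 <= nullcline (arc_fst t), le_dir p2 (arc t),
    le_dir (arc t) p1, arc_fst t <> p1.1 & arc_fst t <> p2.1].
  move: p21; rewrite /le_dir; case: s => -[q1 q2].
    have l12 : p2.1 < p1.1 by rewrite lt_neqAle q1 andbT; apply/eqP => e; apply: neq.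
    have m1 : p2.1 < arc_fst t by rewrite /arc_fst; nra.
    have m2 : arc_fst t < p1.1 by rewrite /arc_fst; nra.
    have n1 := nullcline_decr x2 m1; have n2 := nullcline_decr hx m2.
    rewrite y1 in n2; rewrite y2 in n1.
    split; [exact: le_trans p1y (ltW n2) | by split; exact: ltW | by split; exact: ltW | |].
      by move=> e; move: m2; rewrite e ltxx.
    by move=> e; move: m1; rewrite e ltxx.
  have l12 : p1.1 < p2.1 by rewrite lt_neqAle q1 andbT; apply/eqP.
  have m1 : p1.1 < arc_fst t by rewrite /arc_fst; nra.
  have m2 : arc_fst t < p2.1 by rewrite /arc_fst; nra.
  have n1 := nullcline_decr x1 m1; have n2 := nullcline_decr hx m2.
  rewrite y2 in n2; rewrite y1 in n1.
  split; [exact: le_trans p2y (ltW n2) | by split; exact: ltW | by split; exact: ltW | |].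
    by move=> e; move: m1; rewrite e ltxx.
  by move=> e; move: m2; rewrite e ltxx.
case: key => k1 k2 k3 k4 k5; split => //; [|exact: ne..].
by split => //=; rewrite ltW// (lt_trans hh1).
Qed.

(** On the arc the first coordinate is fixed, so the sign of this displacement alone orders a point
    and its image. *)
Let drift t := (T (arc t)).2 - (arc t).2.

Let drift_neq0 (t : R) : 0 < t < 1 -> drift t != 0.
Proof.
move=> t01; have [Q _ _ n1 n2] := arc_between t01.
apply/eqP => /eqP; rewrite subr_eq0 => /eqP e.
have hx : h1 < arc_fst t by apply: arc_fst_gt; case/andP: t01 => *; rewrite !ltW.
have : equilibria T (arc t).
  split => //; rewrite [LHS]surjective_pairing [RHS]surjective_pairing e.
  by rewrite [(T _).1](nullclineP hx).
by rewrite eqT => -[].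
Qed.

(** A change of sign would produce, by the intermediate value theorem, a third equilibrium strictly
    inside the arc. *)
Let drift_sign (t u : R) : 0 < t < 1 -> 0 < u < 1 -> 0 < drift t -> 0 < drift u.
Proof.
move=> t01 u01 dt; rewrite ltNge le_eqVlt (negbTE (drift_neq0 u01))/=.
apply/negP => du.
have cont (a b : R) : 0 < a -> b < 1 -> {within `[a, b], continuous drift}.
  move=> a0 b1'; apply: continuous_in_subspaceT => z; rewrite inE /= in_itv /= => /andP[za zb].
  have z01 : 0 <= z <= 1 by apply/andP; split; [exact: le_trans (ltW a0) za | exact: le_trans zb (ltW b1')].
  have Q : quadrant (arc z).
    have z01' : 0 < z < 1 by rewrite (lt_le_trans a0 za) (le_lt_trans zb b1').
    by have [] := arc_between z01'.
  have c1' := arc_continuous z01.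
  have c2' := cvg_comp _ _ c1' (sysmap_continuous Q).
  apply: cvgB.
    by move=> P nP; exact (c2' _ (near_snd nP)).
  by move=> P nP; exact (c1' _ (near_snd nP)).
have root (a b : R) : 0 < a -> b < 1 -> a <= b ->
    Num.min (drift a) (drift b) <= 0 <= Num.max (drift a) (drift b) -> False.
  move=> a0 b1' ab /(IVT ab (cont _ _ a0 b1'))[z]; rewrite in_itv /= => /andP[za zb] dz.
  have z01' : 0 < z < 1 by rewrite (lt_le_trans a0 za) (le_lt_trans zb b1').
  by have := drift_neq0 z01'; rewrite dz eqxx.
have [tsu|ut] := leP t u.
  apply: (root t u) => //; [by case/andP: t01 | by case/andP: u01|].
  by rewrite ge_min le_max (ltW du) (ltW dt) orbT.
apply: (root u t) => //; [by case/andP: u01 | by case/andP: t01| exact: ltW|].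
by rewrite ge_min le_max (ltW du) (ltW dt) orbT.
Qed.

Let arc_monotone : (forall t, 0 < t < 1 -> le_dir (arc t) (T (arc t))) \/
                   (forall t, 0 < t < 1 -> le_dir (T (arc t)) (arc t)).
Proof.
have step (t : R) : 0 < t < 1 -> if 0 < drift t then le_se (T (arc t)) (arc t)
                           else le_se (arc t) (T (arc t)).
  move=> t01; have hx : h1 < arc_fst t.
    by apply: arc_fst_gt; case/andP: t01 => *; rewrite !ltW.
  have e : (T (arc t)).1 = (arc t).1 by exact: nullclineP hx.
  case: ifPn => [|]; first by rewrite subr_gt0 => /ltW; split; rewrite ?e.
  by rewrite -leNgt subr_le0; split; rewrite ?e.
have half : 0 < (2^-1 : R) < 1 by apply/andP; split; lra.
have [pos|npos] := boolP (0 < drift 2^-1).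
  have all_pos (t : R) (t01 : 0 < t < 1) := drift_sign half t01 pos.
  rewrite /le_dir; case: s; [right | left] => t t01;
    by have := step t t01; rewrite (all_pos t t01).
have all_neg (t : R) : 0 < t < 1 -> 0 < drift t = false.
  by move=> t01; apply: contraNF npos => dt; exact: drift_sign dt.
rewrite /le_dir; case: s; [left | right] => t t01;
  by have := step t t01; rewrite (all_neg t t01).
Qed.

(* On the nullcline arc joining the equilibria the drift has one sign; were it
   directed towards [p2], points arbitrarily close to [p1] would be attracted
   by [p2]. *)
Lemma equilibrium_on_boundary : C p2.
Proof.
split; first exact: equilibrium_basin equilibrium_snd.
have [x1 y1] := nullcline_equilibrium equilibrium_fst.
have [x2 y2] := nullcline_equilibrium equilibrium_snd.
have arc0 : arc 0 = p1.
  by rewrite /arc /arc_fst mul0r addr0 y1 -surjective_pairing.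
have arc1 : arc 1 = p2.
  by rewrite /arc /arc_fst mul1r subrKC y2 -surjective_pairing.
have [up|down] := arc_monotone.
  (* With the drift directed towards [p1], arc points near [p2] are subsolutions, so the basin of
     [p1] accumulates at [p2]. *)
  move=> U; rewrite -arc1 => nU.
  have c : 0 <= (1 : R) <= 1 by rewrite ler01 lexx.
  have Hn : \forall t \near (1 : R)^'-, U (arc t).
    exact: (cvg_at_left_filter (arc_continuous c) nU).
  have [t [Ut [t0 t1]]] : exists t, U (arc t) /\ (0 < t /\ t < 1).
    apply: (@filter_ex _ ((1 : R)^'-)).
    apply: filterI Hn _; apply: filterI; last exact: nbhs_left_lt.
    exact: nbhs_left_gt.
  have t01 : 0 < t < 1 by rewrite t0.
  have [Q k1 k2 k3 k4] := arc_between t01.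
  exists (arc t); split => //; exact: subsolution_basin (up t t01) k1 k4.
have c : 0 <= (0 : R) <= 1 by rewrite ler01 lexx.
have nU : nbhs (arc 0) [set q | quadrant q -> B1 q].
  by rewrite arc0; apply: basin_open; exact: equilibrium_basin equilibrium_fst.
have Hn : \forall t \near (0 : R)^'+, quadrant (arc t) -> B1 (arc t).
  exact: (cvg_at_right_filter (arc_continuous c) nU).
have [t [Ut [t0 t1]]] : exists t, (quadrant (arc t) -> B1 (arc t)) /\ (0 < t /\ t < 1).
  apply: (@filter_ex _ ((0 : R)^'+)).
  apply: filterI Hn _; apply: filterI; first exact: nbhs_right_gt.
  exact: nbhs_right_lt.
have t01 : 0 < t < 1 by rewrite t0.
have [Q k1 k2 k3 k4] := arc_between t01.
by have := basin_disjoint (Ut Q) (supersolution_basin Q (down t t01) k2 k3).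
Qed.

End two_equilibria.
End system.

(** * Linear analysis at a non-hyperbolic equilibrium *)

Section eigenvectors.
Context {R : realType} (a b c d : R).
Hypotheses (a0 : 0 < a) (b0 : 0 < b) (c0 : 0 < c) (d0 : 0 < d).
Hypothesis det0 : 0 < a * d - b * c.

Definition jac2 : 'M[R]_2 := \matrix_(i, j)
  if i == 0 then if j == 0 then a else - b else if j == 0 then - c else d.

(** Eliminating one entry of an eigenvector leaves the characteristic polynomial times the other
    entry. The field is general so that complex eigenvalues are covered. *)
Lemma eigenvalue2_eq (K : fieldType) (J : 'M[K]_2) (z : K) : eigenvalue J z ->
  (J 0 0 - z) * (J 1 1 - z) = J 0 1 * J 1 0.
Proof.
case/eigenvalueP => v vJ v0.
have e j : v 0 0 * J 0 j + v 0 1 * J 1 j = z * v 0 j.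
  have /matrixP/(_ 0 j) := vJ; rewrite !mxE !big_ord_recl big_ord0 addr0.
  by rewrite (_ : lift ord0 ord0 = 1)//; exact/val_inj.
have e0 := e 0; have e1 := e 1.
have d1 : v 0 0 * ((J 0 0 - z) * (J 1 1 - z) - J 0 1 * J 1 0) = 0.
  have -> : v 0 0 * ((J 0 0 - z) * (J 1 1 - z) - J 0 1 * J 1 0) =
    (v 0 0 * J 0 0 + v 0 1 * J 1 0 - z * v 0 0) * (J 1 1 - z) -
    (v 0 0 * J 0 1 + v 0 1 * J 1 1 - z * v 0 1) * J 1 0 by ring.
  by rewrite e0 e1 !subrr !mul0r subrr.
have d2 : v 0 1 * ((J 0 0 - z) * (J 1 1 - z) - J 0 1 * J 1 0) = 0.
  have -> : v 0 1 * ((J 0 0 - z) * (J 1 1 - z) - J 0 1 * J 1 0) =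
    (v 0 0 * J 0 1 + v 0 1 * J 1 1 - z * v 0 1) * (J 0 0 - z) -
    (v 0 0 * J 0 0 + v 0 1 * J 1 0 - z * v 0 0) * J 0 1 by ring.
  by rewrite e0 e1 !subrr !mul0r subrr.
apply/eqP; rewrite -subr_eq0; apply: contraTT isT => nz.
case/eqP: v0; apply/rowP => j; rewrite mxE.
have [->|->] : j = 0 \/ j = 1.
  by case: j => -[|[|]]// ?; [left | right]; apply/val_inj.
- by move/eqP: d1; rewrite mulf_eq0 (negbTE nz) orbF => /eqP.
- by move/eqP: d2; rewrite mulf_eq0 (negbTE nz) orbF => /eqP.
Qed.

Lemma unit_eigenvalue (z : R[i]) :
  eigenvalue (map_mx (real_complex R) jac2) z -> `|z| = 1 ->
  (1 - a) * (1 - d) = b * c.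
Proof.
move=> /eigenvalue2_eq; rewrite !mxE /=; case: z => u v eqz nz.
have n1 : u ^+ 2 + v ^+ 2 = 1.
  by have := add_Re2_Im2 (u +i* v)%C; rewrite nz expr1n => /(@complexI R _ 1).
move: eqz; simpc => -[re im].
have := a0; have := b0; have := c0; have := d0; have := det0 => D0 pd pc pb pa.
have bc0 : 0 < b * c by rewrite mulr_gt0.
have : v * (2 * u - a - d) = 0 by rewrite -im; ring.
move/eqP; rewrite mulf_eq0 => /orP[/eqP v0|/eqP u0]; last first.
  (* For a non-real eigenvalue the real part is half the trace, and the characteristic equation
     equates a nonpositive number with [b * c]. *)
  have ua : a - u = - ((d - a) / 2) by lra.
  have ud : d - u = (d - a) / 2 by lra.
  move: re; rewrite ua ud => re.
  by have := sqr_ge0 ((d - a) / 2); have := sqr_ge0 v; rewrite !expr2; nra.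
have : (u - 1) * (u + 1) = 0 by move: n1; rewrite v0; nra.
move/eqP; rewrite mulf_eq0 => /orP[/eqP u1|/eqP u1].
  have {}u1 : u = 1 by lra.
  by rewrite -re v0 u1; ring.
(* The value -1 would make [b * c] exceed [a * d], against the positive determinant. *)
have {}u1 : u = -1 by lra.
by move: re; rewrite v0 u1; nra.
Qed.

End eigenvectors.

(** * Splitting into contracting and neutral directions *)

Section hyperbolic_splitting.
Context {R : realType} (a b c d : R).
Hypotheses (a1 : a < 1) (b0 : 0 < b) (c0 : 0 < c) (d1 : d < 1).
Hypothesis char1 : (1 - a) * (1 - d) = b * c.

Let mu := a + d - 1.

(* Coordinates of [v] along the eigenvectors [(b, 1 - d)] (eigenvalue [mu]) and
   [(b, - (1 - a))] (eigenvalue [1]), up to a common factor. *)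
Definition contr_coord (v : R * R) := (1 - a) * v.1 + b * v.2.
Definition neutral_coord (v : R * R) := (1 - d) * v.1 - b * v.2.

Lemma coord_fst v : (2 - a - d) * v.1 = contr_coord v + neutral_coord v.
Proof. by rewrite /contr_coord /neutral_coord; ring. Qed.

Lemma coord_snd v :
  b * (2 - a - d) * v.2 = (1 - d) * contr_coord v - (1 - a) * neutral_coord v.
Proof. by rewrite /contr_coord /neutral_coord; ring. Qed.

Lemma jac2_eigenvalue_mu : eigenvalue (jac2 a b c d) mu.
Proof.
(* [eigenvalue] acts on row vectors; the witness is the coefficient row of [contr_coord]. *)
apply/eigenvalueP; exists (\row_j (if j == 0 then 1 - a else b)).
  apply/rowP => j; rewrite !mxE !big_ord_recl big_ord0 !mxE /= addr0.
  case: ifP => _; last by rewrite /mu; ring.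
  have -> : b * - c = - ((1 - a) * (1 - d)) by rewrite char1; ring.
  by rewrite /mu; ring.
by apply/eqP => /rowP/(_ 1); rewrite !mxE /= => e; have := b0; rewrite e ltxx.
Qed.

Lemma jac2_eigenvalue_1 : eigenvalue (jac2 a b c d) 1.
Proof.
apply/eigenvalueP; exists (\row_j (if j == 0 then 1 - d else - b)).
  apply/rowP => j; rewrite !mxE !big_ord_recl big_ord0 !mxE /= addr0.
  case: ifP => _; last by ring.
  have -> : - b * - c = (1 - a) * (1 - d) by rewrite char1; ring.
  by ring.
apply/eqP => /rowP/(_ 1); rewrite !mxE /= => /eqP; rewrite oppr_eq0 => /eqP e.
by have := b0; rewrite e ltxx.
Qed.

Lemma jac2_eigenspace_mu t : eigenspace2 (jac2 a b c d) mu (t * b, t * (1 - d)).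
Proof.
apply/eigenspaceP; apply/rowP => j.
rewrite !mxE !big_ord_recl big_ord0 !mxE /= addr0 /proj2 /=.
case: ifP => _; first by rewrite /mu; ring.
have -> : t * b * - c = - (t * ((1 - a) * (1 - d))) by rewrite char1; ring.
by rewrite /mu; ring.
Qed.

Lemma coord_bound : exists2 K, 0 < K & forall v,
  `|v.1| + `|v.2| <= K * (`|contr_coord v| + `|neutral_coord v|).
Proof.
have k0 : 0 < 2 - a - d by have := a1; have := d1; lra.
have bk0 : 0 < b * (2 - a - d) by rewrite mulr_gt0.
pose K1 := (2 - a - d)^-1; pose K2 := (b * (2 - a - d))^-1.
have K10 : 0 < K1 by rewrite invr_gt0.
have K20 : 0 < K2 by rewrite invr_gt0.
have a1' : 0 < 1 - a by rewrite subr_gt0.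
have d1' : 0 < 1 - d by rewrite subr_gt0.
exists (K1 + K2 * (1 - d + (1 - a))); first by rewrite addr_gt0 ?mulr_gt0// addr_gt0.
move=> v; set A := contr_coord v; set B := neutral_coord v.
have e1 : v.1 = K1 * (A + B).
  by rewrite -coord_fst /K1 mulKf// gt_eqF.
have e2 : v.2 = K2 * ((1 - d) * A - (1 - a) * B).
  by rewrite -coord_snd /K2 mulKf// gt_eqF.
have A0 := normr_ge0 A; have B0 := normr_ge0 B.
rewrite mulrDl lerD//.
  by rewrite e1 normrM (gtr0_norm K10) ler_pM2l//; exact: ler_normD.
rewrite e2 normrM (gtr0_norm K20) -mulrA ler_pM2l//.
apply: le_trans (ler_normB _ _) _; rewrite !normrM (gtr0_norm a1') (gtr0_norm d1').
by nra.
Qed.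

(** The neutral eigenvector points strictly into the second or fourth quadrant, and so does every
    vector of a narrow cone about its line. *)
Lemma neutral_cone : exists2 k, 0 < k & forall v,
  `|contr_coord v| <= k * `|neutral_coord v| -> neutral_coord v != 0 ->
  (v.1 < 0 /\ 0 < v.2) \/ (0 < v.1 /\ v.2 < 0).
Proof.
have k0 : 0 < 2 - a - d by have := a1; have := d1; lra.
have bk0 : 0 < b * (2 - a - d) by rewrite mulr_gt0.
have a1' : 0 < 1 - a by rewrite subr_gt0.
have d1' : 0 < 1 - d by rewrite subr_gt0.
(* The first bound protects the sign of [v.1] against the contracting coordinate, the second that of
   [v.2]. *)
pose k := Num.min 2^-1 ((1 - a) / (1 - d) / 2).
have kle1 : k <= 2^-1 by rewrite ge_min lexx.
have kle2 : (1 - d) * k <= (1 - a) / 2.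
  rewrite mulrC -ler_pdivlMr//.
  by rewrite (_ : (1 - a) / 2 / (1 - d) = (1 - a) / (1 - d) / 2) ?ge_min ?lexx ?orbT//; ring.
have kgt0 : 0 < k by rewrite lt_min invr_gt0 ltr0n !divr_gt0.
exists k => // v; set A := contr_coord v; set B := neutral_coord v => AB Bn0.
have s1 : (2 - a - d) * v.1 = A + B by exact: coord_fst.
have s2 : b * (2 - a - d) * v.2 = (1 - d) * A - (1 - a) * B by exact: coord_snd.
have [Bpos|Bneg] := ltP 0 B.
  right; rewrite (gtr0_norm Bpos) ler_norml in AB; case/andP: AB => AB1 AB2.
  split.
    by rewrite -(pmulr_rgt0 _ k0) s1; nra.
  by rewrite -(pmulr_rlt0 _ bk0) s2; nra.
have {Bn0}Bneg : B < 0 by rewrite lt_neqAle Bn0.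
left; rewrite (ltr0_norm Bneg) ler_norml in AB; case/andP: AB => AB1 AB2.
split.
  by rewrite -(pmulr_rlt0 _ k0) s1; nra.
by rewrite -(pmulr_rgt0 _ bk0) s2; nra.
Qed.

End hyperbolic_splitting.

(** * Secant slopes near a point and partial derivatives *)

Section slopes.
Context {R : realType} (b c h : R) (b0 : 0 < b) (c0 : 0 < c).

Lemma slope_cvg (p : R * R) : 0 <= p.1 -> 0 <= p.2 ->
  slope_x b c x.1.1 x.1.2 x.2.1 x.2.2 @[x --> (p, p)] --> slope_x b c p.1 p.2 p.1 p.2 /\
  slope_y b c x.1.1 x.1.2 x.2.1 x.2.2 @[x --> (p, p)] --> slope_y b c p.1 p.2 p.1 p.2.
Proof.
move=> x0 y0; have D0 := response_den_gt0 c0 x0 y0.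
have p1 : x.1 @[x --> (p, p)] --> p by exact: cvg_fst.
have p2 : x.2 @[x --> (p, p)] --> p by exact: cvg_snd.
have p11 : x.1.1 @[x --> (p, p)] --> p.1 by move=> P nP; exact (p1 _ (near_fst nP)).
have p12 : x.1.2 @[x --> (p, p)] --> p.2 by move=> P nP; exact (p1 _ (near_snd nP)).
have p21 : x.2.1 @[x --> (p, p)] --> p.1 by move=> P nP; exact (p2 _ (near_fst nP)).
have p22 : x.2.2 @[x --> (p, p)] --> p.2 by move=> P nP; exact (p2 _ (near_snd nP)).
have den : ((1 + x.1.1 + c * x.1.2) * (1 + x.2.1 + c * x.2.2))^-1 @[x --> (p, p)] -->
    ((1 + p.1 + c * p.2) * (1 + p.1 + c * p.2))^-1.
  apply: cvgV; first by rewrite mulf_neq0// gt_eqF.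
  apply: cvgM; apply: cvgD.
  - by apply: cvgD; [exact: cvg_cst | exact: p11].
  - by apply: cvgM; [exact: cvg_cst | exact: p12].
  - by apply: cvgD; [exact: cvg_cst | exact: p21].
  - by apply: cvgM; [exact: cvg_cst | exact: p22].
split; apply: cvgM => //; (apply: cvgM; first exact: cvg_cst).
  by apply: cvgD; [exact: cvg_cst | apply: cvgM; [exact: cvg_cst | exact: p12]].
by apply: cvgM; [exact: cvg_cst | exact: p11].
Qed.

Lemma slope_near (p : R * R) e : 0 <= p.1 -> 0 <= p.2 -> 0 < e ->
  exists2 U, nbhs p U & forall z w, U z -> U w ->
    `|slope_x b c z.1 z.2 w.1 w.2 - slope_x b c p.1 p.2 p.1 p.2| <= e /\
    `|slope_y b c z.1 z.2 w.1 w.2 - slope_y b c p.1 p.2 p.1 p.2| <= e.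
Proof.
move=> x0 y0 e0; have [L1 L2] := slope_cvg x0 y0.
have N1 : \forall x \near (p, p), `|slope_x b c x.1.1 x.1.2 x.2.1 x.2.2 -
    slope_x b c p.1 p.2 p.1 p.2| <= e.
  by have /cvgrPdist_le/(_ e e0) := L1; apply: filterS => x; rewrite distrC.
have N2 : \forall x \near (p, p), `|slope_y b c x.1.1 x.1.2 x.2.1 x.2.2 -
    slope_y b c p.1 p.2 p.1 p.2| <= e.
  by have /cvgrPdist_le/(_ e e0) := L2; apply: filterS => x; rewrite distrC.
have [[U V] [/= nU nV] sub] := filterI N1 N2.
exists (U `&` V); first exact: filterI.
by move=> z w [Uz _] [_ Vw]; have := sub (z, w) (conj Uz Vw).
Qed.

Lemma slope_gt0 x y x' y' : 0 < x -> 0 <= y -> 0 <= x' -> 0 <= y' ->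
  0 < slope_x b c x y x' y' /\ 0 < slope_y b c x y x' y'.
Proof.
move=> x0 y0 x0' y0'; have D := response_den_gt0 c0 (ltW x0) y0.
have D' := response_den_gt0 c0 x0' y0'.
have cy := mulr_ge0 (ltW c0) y0.
split; first by rewrite divr_gt0 ?mulr_gt0//; lra.
by rewrite divr_gt0 ?mulr_gt0.
Qed.

(** At a fixed point the positive [h] forces [b] below the denominator, and the slope is a product
    of two ratios less than 1. *)
Lemma slope_x_lt1 x y : 0 < x -> 0 <= y -> response b c h x y = x -> 0 < h ->
  slope_x b c x y x y < 1.
Proof.
move=> x0 y0 e h0; have D := response_den_gt0 c0 (ltW x0) y0.
have cy := mulr_ge0 (ltW c0) y0.
have bD : b < 1 + x + c * y.
  rewrite -(ltr_pM2r x0) mulrC; move: e; rewrite /response => e.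
  have : b * x / (1 + x + c * y) < x by lra.
  by rewrite ltr_pdivrMr// [X in _ < X]mulrC [X in X < _]mulrC.
rewrite /slope_x ltr_pdivrMr ?mulr_gt0// mul1r.
by apply: ltr_pM => //; [exact: ltW | lra | lra].
Qed.

Lemma derive_response x y : 0 <= x -> 0 <= y ->
  (fun t => response b c h t y)^`() x = slope_x b c x y x y /\
  (fun t => response b c h x t)^`() y = - slope_y b c x y x y.
Proof.
move=> x0 y0; have D := response_den_gt0 c0 x0 y0.
have Dn : 1 + x + c * y != 0 by rewrite gt_eqF.
split; rewrite derive1E; apply: derive_val.
  rewrite /response; apply: is_derive_eq.
  by rewrite /slope_x /GRing.scale /=; field.
rewrite /response; apply: is_derive_eq.
by rewrite /slope_y /GRing.scale /=; field.
Qed.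

End slopes.

(** * Linearization at the equilibrium and trapped orbits *)

Section linearization.
Context {R : realType} (b1 b2 c1 c2 h1 h2 : R)
  (hb1 : 0 < b1) (hb2 : 0 < b2) (hc1 : 0 < c1) (hc2 : 0 < c2)
  (hh1 : 0 < h1) (hh2 : 0 < h2).
Implicit Types (q u v w z : R * R).

Let T := sysmap b1 b2 c1 c2 h1 h2.

Context (p : R * R) (eqp : equilibria T p).

Let ja := slope_x b1 c1 p.1 p.2 p.1 p.2.
Let jb := slope_y b1 c1 p.1 p.2 p.1 p.2.
Let jc := slope_y b2 c2 p.2 p.1 p.2 p.1.
Let jd := slope_x b2 c2 p.2 p.1 p.2 p.1.

Let p1_gt0 : 0 < p.1.
Proof.
have [Q Tp] := eqp; have [g _] := sysmap_ge h1 h2 hb1 hb2 hc1 hc2 Q.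
by rewrite -/T Tp in g; exact: lt_le_trans g.
Qed.

Let p2_gt0 : 0 < p.2.
Proof.
have [Q Tp] := eqp; have [_ g] := sysmap_ge h1 h2 hb1 hb2 hc1 hc2 Q.
by rewrite -/T Tp in g; exact: lt_le_trans g.
Qed.

Let p1_ge0 := ltW p1_gt0.
Let p2_ge0 := ltW p2_gt0.

Let ja_gt0 : 0 < ja.
Proof. exact: (slope_gt0 hb1 hc1 p1_gt0 p2_ge0 p1_ge0 p2_ge0).1. Qed.
Let jb_gt0 : 0 < jb.
Proof. exact: (slope_gt0 hb1 hc1 p1_gt0 p2_ge0 p1_ge0 p2_ge0).2. Qed.
Let jc_gt0 : 0 < jc.
Proof. exact: (slope_gt0 hb2 hc2 p2_gt0 p1_ge0 p2_ge0 p1_ge0).2. Qed.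
Let jd_gt0 : 0 < jd.
Proof. exact: (slope_gt0 hb2 hc2 p2_gt0 p1_ge0 p2_ge0 p1_ge0).1. Qed.

Let ja_lt1 : ja < 1.
Proof.
apply: (slope_x_lt1 hb1 hc1 p1_gt0 p2_ge0 _ hh1).
by have [_ Tp] := eqp; exact: (congr1 fst Tp).
Qed.

Let jd_lt1 : jd < 1.
Proof.
apply: (slope_x_lt1 hb2 hc2 p2_gt0 p1_ge0 _ hh2).
by have [_ Tp] := eqp; exact: (congr1 snd Tp).
Qed.

Lemma jacobian_det_gt0 : 0 < ja * jd - jb * jc.
Proof.
have D1 := response_den_gt0 hc1 p1_ge0 p2_ge0.
have D2 := response_den_gt0 hc2 p2_ge0 p1_ge0.
have k1 : 0 < c1 * p.2 by rewrite mulr_gt0.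
have k2 : 0 < c2 * p.1 by rewrite mulr_gt0.
rewrite (_ : _ - _ = b1 * b2 * (1 + c1 * p.2 + c2 * p.1) /
  ((1 + p.1 + c1 * p.2) * (1 + p.2 + c2 * p.1)) ^+ 2).
  by rewrite divr_gt0 ?exprn_gt0 ?mulr_gt0//; lra.
by rewrite /ja /jb /jc /jd /slope_x /slope_y; field; rewrite !gt_eqF.
Qed.

Lemma jacobian_sysmap : jacobian2 T p = jac2 ja jb jc jd.
Proof.
apply/matrixP => i j; rewrite !mxE /proj2; case: (i == 0); case: (j == 0).
- exact: (derive_response b1 h1 hc1 p1_ge0 p2_ge0).1.
- exact: (derive_response b1 h1 hc1 p1_ge0 p2_ge0).2.
- exact: (derive_response b2 h2 hc2 p2_ge0 p1_ge0).2.
- exact: (derive_response b2 h2 hc2 p2_ge0 p1_ge0).1.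
Qed.

Hypothesis nhyp : non_hyperbolic T p.

Lemma jacobian_char1 : (1 - ja) * (1 - jd) = jb * jc.
Proof.
have [z] := nhyp; rewrite jacobian_sysmap.
by apply: unit_eigenvalue => //; exact: jacobian_det_gt0.
Qed.

Let mu := ja + jd - 1.

(** The determinant is the product of the eigenvalues 1 and [mu]. *)
Let mu_gt0 : 0 < mu.
Proof.
have := jacobian_det_gt0; rewrite -jacobian_char1 (_ : _ - _ = mu)//.
by rewrite /mu; ring.
Qed.

Let mu_lt1 : mu < 1.
Proof. by have := ja_lt1; have := jd_lt1; rewrite /mu; lra. Qed.

Lemma jacobian_smaller_eigenvalue : smaller_eigenvalue (jacobian2 T p) mu.
Proof.
rewrite jacobian_sysmap; split.
  by apply: jac2_eigenvalue_mu => //; exact: jacobian_char1.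
exists 1; first by apply: jac2_eigenvalue_1 => //; exact: jacobian_char1.
by rewrite normr1 gtr0_norm.
Qed.

(** Coordinates of the splitting centred at [p], with the norm in which linearization errors are
    measured. *)
Let al q := contr_coord ja jb (q - p).
Let be q := neutral_coord jb jd (q - p).
Let nrm q := `|al q| + `|be q|.

Let nrm_ge0 q : 0 <= nrm q. Proof. by rewrite addr_ge0. Qed.

Let sysmap_sub z w : quadrant z -> quadrant w ->
  (T w - T z).1 = slope_x b1 c1 z.1 z.2 w.1 w.2 * (w - z).1 -
                  slope_y b1 c1 z.1 z.2 w.1 w.2 * (w - z).2 /\
  (T w - T z).2 = slope_x b2 c2 z.2 z.1 w.2 w.1 * (w - z).2 -
                  slope_y b2 c2 z.2 z.1 w.2 w.1 * (w - z).1.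
Proof.
move=> [z1 z2] [w1 w2].
by split; [exact: (response_sub b1 h1 hc1 z1 z2 w1 w2) |
           exact: (response_sub b2 h2 hc2 z2 z1 w2 w1)].
Qed.

Let near_slopes e : 0 < e -> exists2 U, nbhs p U & forall z w, U z -> U w ->
  [/\ `|slope_x b1 c1 z.1 z.2 w.1 w.2 - ja| <= e,
      `|slope_y b1 c1 z.1 z.2 w.1 w.2 - jb| <= e,
      `|slope_y b2 c2 z.2 z.1 w.2 w.1 - jc| <= e &
      `|slope_x b2 c2 z.2 z.1 w.2 w.1 - jd| <= e].
Proof.
move=> e0; have [U nU HU] := slope_near b1 hc1 p1_ge0 p2_ge0 e0.
have [V nV HV] := @slope_near _ b2 c2 hc2 (p.2, p.1) e p2_ge0 p1_ge0 e0.
have nV' : \forall q \near p, V (q.2, q.1).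
  have s1 : x.1 @[x --> p] --> p.1 by exact: cvg_fst.
  have s2 : x.2 @[x --> p] --> p.2 by exact: cvg_snd.
  exact (cvg_pair s2 s1 nV).
exists (U `&` [set q | V (q.2, q.1)]); first exact: filterI.
move=> z w [Uz Vz] [Uw Vw].
by have [A B] := HU z w Uz Uw; have [D C] := HV _ _ Vz Vw; split.
Qed.

Let combo_le (x y s t e : R) : `|x| <= e -> `|y| <= e ->
  `|x * s - y * t| <= e * (`|s| + `|t|).
Proof.
move=> xe ye; apply: le_trans (ler_normB _ _) _.
by rewrite !normrM mulrDr lerD// ler_wpM2r.
Qed.

(** By the exact increment formula the error is due only to the deviation of the secant slopes from
    the Jacobian entries. *)
Let linearization_step e : 0 < e -> \forall q \near p, quadrant q ->
  `|al (T q) - mu * al q| <= e * nrm q /\ `|be (T q) - be q| <= e * nrm q.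
Proof.
move=> e0; have [Qp Tp] := eqp.
have [K K0 HK] := coord_bound ja_lt1 jb_gt0 jd_lt1.
pose M := (1 - ja) + jb + (1 - jd).
have a1 : 0 < 1 - ja by rewrite subr_gt0.
have d1 : 0 < 1 - jd by rewrite subr_gt0.
have M0 : 0 < M by have := jb_gt0; rewrite /M; lra.
(* [M] dominates the weights of both coordinates and [K] bounds the original increments by [nrm], so
   this tolerance for the slopes yields [e]. *)
have de0 : 0 < e / (M * K) by rewrite divr_gt0 ?mulr_gt0.
have [U nU HU] := near_slopes de0.
have Up := nbhs_singleton nU; apply: filterS nU => q Uq Qq.
have [A B C D] := HU p q Up Uq.
have [e1 e2] := sysmap_sub Qp Qq; rewrite Tp in e1 e2.
set s := (q - p).1 in e1 e2; set t := (q - p).2 in e1 e2.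
have X := combo_le s t A B; have Y := combo_le t s D C.
set N := `|s| + `|t| in X; rewrite [`|t| + _]addrC -/N in Y.
have bound (k1 k2 : R) : 0 <= k1 -> 0 <= k2 -> k1 + k2 <= M -> forall u v : R,
    `|u| <= e / (M * K) * N -> `|v| <= e / (M * K) * N ->
    `|k1 * u + k2 * v| <= e * nrm q.
  move=> k10 k20 kM u v ub vb; apply: le_trans (ler_normD _ _) _.
  rewrite !normrM (ger0_norm k10) (ger0_norm k20).
  apply: (@le_trans _ _ (M * (e / (M * K) * N))).
    apply: (@le_trans _ _ ((k1 + k2) * (e / (M * K) * N))).
      by rewrite mulrDl lerD// ler_wpM2l.
    by rewrite ler_wpM2r// (le_trans _ ub).
  rewrite (_ : M * _ = e / K * N); last by field; rewrite !gt_eqF.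
  rewrite -[leRHS](_ : e / K * (K * nrm q) = _); last by field; rewrite gt_eqF.
  rewrite ler_pM2l ?divr_gt0//; exact: HK.
split.
  rewrite (_ : _ - _ = (1 - ja) *
      ((slope_x b1 c1 p.1 p.2 q.1 q.2 - ja) * s - (slope_y b1 c1 p.1 p.2 q.1 q.2 - jb) * t) +
    jb * ((slope_x b2 c2 p.2 p.1 q.2 q.1 - jd) * t - (slope_y b2 c2 p.2 p.1 q.2 q.1 - jc) * s)).
    by apply: bound => //; rewrite ?ltW// /M; lra.
  rewrite /al /contr_coord e1 e2 -/s -/t /mu; apply/eqP; rewrite -subr_eq0; apply/eqP.
  rewrite (_ : _ - _ = s * ((1 - ja) * (1 - jd) - jb * jc)); last by ring.
  by rewrite jacobian_char1 subrr mulr0.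
rewrite (_ : _ - _ = (1 - jd) *
    ((slope_x b1 c1 p.1 p.2 q.1 q.2 - ja) * s - (slope_y b1 c1 p.1 p.2 q.1 q.2 - jb) * t) +
  jb * - ((slope_x b2 c2 p.2 p.1 q.2 q.1 - jd) * t - (slope_y b2 c2 p.2 p.1 q.2 q.1 - jc) * s)).
  apply: bound; [exact: ltW d1 | exact: ltW jb_gt0 | by rewrite /M; lra | exact: X |].
  by rewrite normrN.
rewrite /be /neutral_coord e1 e2 -/s -/t; apply/eqP; rewrite -subr_eq0; apply/eqP.
rewrite (_ : _ - _ = s * (jb * jc - (1 - ja) * (1 - jd))); last by ring.
by rewrite jacobian_char1 subrr mulr0.
Qed.

Let near_iter n (P : set (R * R)) : nbhs p P -> \forall q \near p, P (iter n T q).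
Proof.
move=> nP; have [Qp Tp] := eqp.
apply: (@iter_continuous _ b1 b2 c1 c2 h1 h2 hb1 hb2 hc1 hc2 hh1 hh2 n p Qp P).
by rewrite -/T iter_equilibrium.
Qed.

Let iter_quad n q : quadrant q -> quadrant (iter n T q).
Proof. exact: iter_quadrant. Qed.

Let linearization_iter n e : 0 < e -> \forall q \near p, quadrant q ->
  `|al (iter n T q) - mu ^+ n * al q| <= e * nrm q /\
  `|be (iter n T q) - be q| <= e * nrm q.
Proof.
elim: n e => [|n IH] e e0.
  by apply: filterE => q _; rewrite /= expr0 mul1r !subrr normr0 mulr_ge0// ltW.
(* The last step starts from a point with [nrm] at most three times that of [q], and the inherited
   error adds one more [e'], hence the quarter. The minimum with 1 secures the factor three. *)
pose e' := Num.min 1 e / 4.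
have m0 : 0 < Num.min 1 e by rewrite lt_min ltr01.
have m1 : Num.min 1 e <= 1 by rewrite ge_min lexx.
have m2 : Num.min 1 e <= e by rewrite ge_min lexx orbT.
have e'0 : 0 < e' by rewrite divr_gt0.
have e'1 : e' <= 1 by rewrite /e'; lra.
have e'e : 4 * e' <= e by rewrite /e'; lra.
apply: filterS2 (IH _ e'0) (near_iter n (linearization_step e'0)) => q H1 H2 Qq.
have [A1 B1] := H1 Qq; have [A2 B2] := H2 (iter_quad n Qq).
rewrite -/(iter n.+1 T q) in A2 B2.
have g0 := nrm_ge0 q.
have mun : mu ^+ n <= 1 by rewrite exprn_ile1// ltW.
have mun0 : 0 <= mu ^+ n by rewrite exprn_ge0// ltW.
have small : nrm (iter n T q) <= 3 * nrm q.
  have a3 : `|al (iter n T q)| <= `|al q| + e' * nrm q.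
    rewrite -[X in `|X|](subrK (mu ^+ n * al q)) addrC.
    apply: le_trans (ler_normD _ _) _; rewrite lerD// normrM (ger0_norm mun0).
    by rewrite ler_piMl.
  have b3 : `|be (iter n T q)| <= `|be q| + e' * nrm q.
    rewrite -[X in `|X|](subrK (be q)) addrC.
    by apply: le_trans (ler_normD _ _) _; rewrite lerD.
  by move: a3 b3 g0; rewrite /nrm; nra.
split.
  rewrite exprS (_ : _ - _ = (al (iter n.+1 T q) - mu * al (iter n T q)) +
    mu * (al (iter n T q) - mu ^+ n * al q)); last by ring.
  apply: le_trans (ler_normD _ _) _; rewrite normrM (gtr0_norm mu_gt0).
  have : mu * `|al (iter n T q) - mu ^+ n * al q| <= e' * nrm q.
    apply: le_trans A1; rewrite ler_piMl// ltW//.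
  by nra.
rewrite (_ : _ - _ = (be (iter n.+1 T q) - be (iter n T q)) + (be (iter n T q) - be q));
  last by ring.
by apply: le_trans (ler_normD _ _) _; nra.
Qed.

(** The open second and fourth quadrants at [p]; trapped orbits are those that never meet them. *)
Definition sidewise q := se_lt q p \/ se_lt p q.

(* Off the contracting direction the neutral coordinate eventually dominates,
   which puts the orbit in the open second or fourth quadrant at [p]. *)
Let cone_exit eta : 0 < eta -> exists n, \forall q \near p,
  quadrant q -> eta * `|al q| < `|be q| -> sidewise (iter n T q).
Proof.
move=> eta0; have [k k0 Hk] := neutral_cone ja_lt1 jb_gt0 jd_lt1.
have keta : 0 < k * eta / 4 by rewrite divr_gt0 ?mulr_gt0.
have [n _ /(_ n (leqnn n)) /= mun] : \forall n \near \oo, mu ^+ n < k * eta / 4.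
  have lim : mu ^+ n @[n --> \oo] --> (0 : R).
    by apply: cvg_expr; rewrite gtr0_norm.
  exact: (cvgr_lt _ lim).
have mun0 : 0 <= mu ^+ n by rewrite exprn_ge0// ltW.
(* Here [nrm q] is at most [eta^-1 + 1] times the modulus of [be q], so the errors stay below both a
   half and [k / 4] of that modulus. *)
pose e := Num.min 2^-1 (k / 4) / (eta^-1 + 1).
have m0 : 0 < Num.min 2^-1 (k / 4) by rewrite lt_min invr_gt0 ltr0n divr_gt0.
have m1 : Num.min 2^-1 (k / 4) <= 2^-1 by rewrite ge_min lexx.
have m2 : Num.min 2^-1 (k / 4) <= k / 4 by rewrite ge_min lexx orbT.
have i0 : 0 < eta^-1 + 1 by rewrite addr_gt0 ?invr_gt0.
have e0 : 0 < e by rewrite divr_gt0.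
exists n; apply: filterS (linearization_iter n e0) => q H Qq big.
have [A B] := H Qq.
have al_le : `|al q| <= eta^-1 * `|be q|.
  by rewrite mulrC ler_pdivlMr// mulrC ltW.
have nrm_le : e * nrm q <= Num.min 2^-1 (k / 4) * `|be q|.
  have -> : Num.min 2^-1 (k / 4) = e * (eta^-1 + 1) by rewrite /e divfK// gt_eqF.
  rewrite -mulrA ler_pM2l//.
  by rewrite /nrm mulrDl mul1r lerD2r.
have be0 : 0 < `|be q| by apply: le_lt_trans big; rewrite mulr_ge0// ltW.
have near_be : `|be q| / 2 <= `|be (iter n T q)|.
  have : `|be q| <= `|be (iter n T q)| + e * nrm q.
    rewrite -[X in `|X| <= _](subKr (be (iter n T q))).
    apply: le_trans (ler_normB _ _) _; by rewrite lerD.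
  by nra.
have near_al : `|al (iter n T q)| <= k / 2 * `|be q|.
  rewrite -[X in `|X|](subrK (mu ^+ n * al q)) addrC.
  apply: le_trans (ler_normD _ _) _; rewrite normrM (ger0_norm mun0).
  have : mu ^+ n * `|al q| <= k / 4 * `|be q|.
    apply: (@le_trans _ _ (k * eta / 4 * (eta^-1 * `|be q|))).
      by rewrite ler_pM// ltW.
    by rewrite le_eqVlt; apply/orP; left; apply/eqP; field; rewrite gt_eqF.
  by nra.
have [||[l1 l2]|[l1 l2]] := Hk (iter n T q - p).
- by rewrite -/(al _) -/(be _); nra.
- by rewrite -/(be _) -normr_gt0; lra.
- by left; split; [rewrite -subr_lt0; exact: l1 | rewrite -subr_gt0; exact: l2].
- by right; split; [rewrite -subr_gt0; exact: l1 | rewrite -subr_lt0; exact: l2].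
Qed.

(** Contrapositive of [cone_exit]: near [p], trapped orbits start in an arbitrarily thin cone about
    the contracting direction. *)
Lemma trapped_cone eta : 0 < eta -> \forall q \near p, quadrant q ->
  (forall n, ~ sidewise (iter n T q)) -> `|be q| <= eta * `|al q|.
Proof.
move=> eta0; have [n Hn] := cone_exit eta0.
apply: filterS Hn => q H Qq trapped; rewrite leNgt; apply/negP => big.
exact: (trapped n (H Qq big)).
Qed.

(** For ordered points all contributions to the increment have one sign, so lower bounds on the
    slopes suffice; the exact Jacobian preserves the neutral coordinate. *)
Let neutral_expand e : 0 < e -> exists2 U, nbhs p U & forall z w,
  U z -> U w -> quadrant z -> quadrant w -> le_se z w ->
  (1 - e) * (be w - be z) <= be (T w) - be (T z).
Proof.
move=> e0.
have a1 : 0 < 1 - ja by rewrite subr_gt0.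
have d1 : 0 < 1 - jd by rewrite subr_gt0.
(* As [r] is the least entry, an error of [e * r] is a relative error of at most [e]. *)
pose r := Num.min (Num.min ja jb) (Num.min jc jd).
have r0 : 0 < r by rewrite !lt_min ja_gt0 jb_gt0 jc_gt0 jd_gt0.
have ra : r <= ja by rewrite !ge_min lexx.
have rb : r <= jb by rewrite !ge_min lexx orbT.
have rc : r <= jc by rewrite !ge_min lexx !orbT.
have rd : r <= jd by rewrite !ge_min lexx !orbT.
have er0 : 0 < e * r by rewrite mulr_gt0.
have [U nU HU] := near_slopes er0; exists U => // z w Uz Uw Qz Qw [zw1 zw2].
have [A B C D] := HU z w Uz Uw; have [e1 e2] := sysmap_sub Qz Qw.
have low (x y : R) : `|x - y| <= e * r -> r <= y -> (1 - e) * y <= x.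
  rewrite ler_norml => /andP[lo _] ry; have : e * r <= e * y by rewrite ler_pM2l.
  by lra.
have {}A := low _ _ A ra; have {}B := low _ _ B rb.
have {}C := low _ _ C rc; have {}D := low _ _ D rd.
set s := (w - z).1 in e1 e2; set t := (w - z).2 in e1 e2.
have s0 : 0 <= s by rewrite subr_ge0.
have t0 : 0 <= - t by rewrite oppr_ge0 subr_le0.
have -> : be w - be z = (1 - jd) * s - jb * t.
  by rewrite /be /neutral_coord /s /t /=; ring.
have -> : be (T w) - be (T z) = (1 - jd) * (T w - T z).1 - jb * (T w - T z).2.
  by rewrite /be /neutral_coord /=; ring.
rewrite e1 e2.
set A' := slope_x b1 _ _ _ _ _ in A *; set B' := slope_y b1 _ _ _ _ _ in B *.
set C' := slope_y b2 _ _ _ _ _ in C *; set D' := slope_x b2 _ _ _ _ _ in D *.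
rewrite [leRHS](_ : _ = (1 - jd) * (A' * s + B' * - t) + jb * (D' * - t + C' * s));
  last by ring.
apply: (@le_trans _ _ ((1 - jd) * ((1 - e) * ja * s + (1 - e) * jb * - t) +
                       jb * ((1 - e) * jd * - t + (1 - e) * jc * s))); last first.
  by apply: lerD; rewrite ler_pM2l//; apply: lerD; rewrite ler_wpM2r.
rewrite le_eqVlt; apply/orP; left; rewrite -subr_eq0; apply/eqP.
rewrite (_ : _ - _ = (1 - e) * s * ((1 - ja) * (1 - jd) - jb * jc)); last by ring.
by rewrite jacobian_char1 subrr mulr0.
Qed.

(* Two such orbits would approach [p] at the rate [mu], whereas the neutral
   coordinate of their difference cannot decay that fast. *)
Lemma trapped_pair z w : quadrant z -> quadrant w -> le_se z w -> z <> w ->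
  iter n T z @[n --> \oo] --> p -> iter n T w @[n --> \oo] --> p ->
  (forall n, ~ sidewise (iter n T z)) -> (forall n, ~ sidewise (iter n T w)) ->
  False.
Proof.
move=> Qz Qw zw neq zp wp tz tw.
(* This makes [mu + 2 * e] equal to [(1 + mu) / 2], which is still less than [1 - e]. *)
pose e := (1 - mu) / 4.
have e0 : 0 < e by rewrite divr_gt0// subr_gt0.
have e1 : e < 1 by have := mu_gt0; rewrite /e; lra.
have [U nU HU] := neutral_expand e0.
have good : \forall q \near p, quadrant q -> (forall n, ~ sidewise (iter n T q)) ->
    `|be q| <= `|al q| /\ `|al (T q)| <= (1 + mu) / 2 * `|al q|.
  apply: filterS2 (trapped_cone ltr01) (linearization_step e0) => q H1 H2 Qq tq.
  have := H1 Qq tq; rewrite mul1r => H; split => //.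
  have [A _] := H2 Qq.
  rewrite -[X in `|X|](subrK (mu * al q)) addrC.
  apply: le_trans (ler_normD _ _) _; rewrite normrM (gtr0_norm mu_gt0).
  have m1 : 0 <= (1 - mu) * (`|al q| - `|be q|).
    by rewrite mulr_ge0 ?subr_ge0// ltW.
  by move: A m1; rewrite /nrm /e; lra.
have tail q n : (forall n, ~ sidewise (iter n T q)) ->
    forall m, ~ sidewise (iter m T (iter n T q)).
  by move=> tq m; rewrite -iterD; exact: tq.
have [N1 _ HN1] := zp _ (filterI nU good).
have [N2 _ HN2] := wp _ (filterI nU good).
pose N := maxn N1 N2.
have Gz n : U (iter (n + N) T z) /\ [/\ `|be (iter (n + N) T z)| <= `|al (iter (n + N) T z)| &
    `|al (iter (n.+1 + N) T z)| <= (1 + mu) / 2 * `|al (iter (n + N) T z)|].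
  have [|u1 u2] := HN1 (n + N)%N; first by rewrite /= (leq_trans (leq_maxl N1 N2))// leq_addl.
  by split => //; have [] := u2 (iter_quad _ Qz) (tail z _ tz).
have Gw n : U (iter (n + N) T w) /\ [/\ `|be (iter (n + N) T w)| <= `|al (iter (n + N) T w)| &
    `|al (iter (n.+1 + N) T w)| <= (1 + mu) / 2 * `|al (iter (n + N) T w)|].
  have [|u1 u2] := HN2 (n + N)%N; first by rewrite /= (leq_trans (leq_maxr N1 N2))// leq_addl.
  by split => //; have [] := u2 (iter_quad _ Qw) (tail w _ tw).
pose gap n := be (iter (n + N) T w) - be (iter (n + N) T z).
pose size n := `|al (iter (n + N) T w)| + `|al (iter (n + N) T z)|.
have gap_size n : gap n <= size n.
  have [_ [g1 _]] := Gz n; have [_ [g2 _]] := Gw n.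
  apply: le_trans (ler_norm _) _; apply: le_trans (ler_normB _ _) _.
  exact: lerD.
have gap_grow n : (1 - e) * gap n <= gap n.+1.
  have [u1 _] := Gz n; have [u2 _] := Gw n.
  apply: HU => //; [exact: iter_quad..|].
  exact: iter_le_se.
have size_decay n : size n.+1 <= (1 + mu) / 2 * size n.
  have [_ [_ g1]] := Gz n; have [_ [_ g2]] := Gw n.
  by rewrite mulrDr lerD.
(* The neutral coordinate increases strictly in the south-east order, and injectivity keeps the two
   orbits distinct. *)
have gap0 : 0 < gap 0%N.
  have neqn n : iter n T z <> iter n T w.
    elim: n => //= n IH /(sysmap_inj hb1 hb2 hc1 hc2 (iter_quad n Qz) (iter_quad n Qw)).
    exact: IH.
  have [l1 l2] : le_se (iter (0 + N) T z) (iter (0 + N) T w) by exact: iter_le_se.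
  have := neqn (0 + N)%N; rewrite /gap.
  move: (iter _ _ z) (iter _ _ w) l1 l2 => u v l1 l2 uv.
  have d1 : 0 < 1 - jd by rewrite subr_gt0.
  have -> : be v - be u = (1 - jd) * (v.1 - u.1) + jb * (u.2 - v.2).
    by rewrite /be /neutral_coord /=; ring.
  have s0 : 0 <= (1 - jd) * (v.1 - u.1) by rewrite mulr_ge0 ?subr_ge0// ltW.
  have t0 : 0 <= jb * (u.2 - v.2) by rewrite mulr_ge0 ?subr_ge0// ltW.
  rewrite lt_neqAle addr_ge0// andbT.
  apply/eqP => /esym/eqP; rewrite paddr_eq0//.
  rewrite (mulf_eq0 (1 - jd)) (mulf_eq0 jb) (gt_eqF d1) (gt_eqF jb_gt0)/= !subr_eq0 => /andP[/eqP e1' /eqP e2'].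
  by apply: uv; apply: le_se_anti; split; rewrite ?e1' ?e2'.
apply: (@geometric_gap R ((1 + mu) / 2) (1 - e) (gap 0%N) (size 0%N)) => //.
- by have := mu_gt0; lra.
- by have := mu_lt1; rewrite /e; lra.
move=> k.
have p1 : gap 0%N * (1 - e) ^+ k <= gap k.
  elim: k => [|k IH]; first by rewrite expr0 mulr1.
  apply: le_trans (gap_grow k); rewrite exprS mulrCA ler_pM2l//; lra.
have p2 : size k <= size 0%N * ((1 + mu) / 2) ^+ k.
  elim: k {p1} => [|k IH]; first by rewrite expr0 mulr1.
  apply: le_trans (size_decay k) _; rewrite exprS mulrCA ler_pM2l//.
  by have := mu_gt0; lra.
exact: le_trans p1 (le_trans (gap_size k) p2).
Qed.

Lemma trapped_tangential (C : set (R * R)) : C `<=` quadrant ->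
  (forall q, C q -> forall n, ~ sidewise (iter n T q)) ->
  tangential C p (eigenspace2 (jacobian2 T p) mu).
Proof.
move=> CQ trapped e e0.
have a1 : 0 < 1 - ja by rewrite subr_gt0.
have k0 : 0 < 2 - ja - jd by have := ja_lt1; have := jd_lt1; lra.
have bk0 : 0 < jb * (2 - ja - jd) by rewrite mulr_gt0.
pose k := (jb * (2 - ja - jd))^-1.
have kgt0 : 0 < k by rewrite invr_gt0.
pose M := jb + (1 - ja).
have M0 : 0 < M by rewrite addr_gt0.
have eta0 : 0 < e / (k * M * M) by rewrite divr_gt0 ?mulr_gt0.
rewrite near_withinE; apply: nbhs_dnbhs.
apply: filterS (trapped_cone eta0) => q H Cq.
have {}H := H (CQ _ Cq) (trapped q Cq).
(* The contracting component of [q - p]; what remains is the neutral component, small by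
   [trapped_cone]. *)
exists (k * al q * jb, k * al q * (1 - jd)).
  by rewrite jacobian_sysmap; apply: jac2_eigenspace_mu; exact: jacobian_char1.
have -> : q - p - (k * al q * jb, k * al q * (1 - jd)) =
    (k * be q * jb, k * be q * - (1 - ja)).
  have E1 := coord_fst ja jb jd (q - p); have E2 := coord_snd ja jb jd (q - p).
  rewrite -/(al q) -/(be q) in E1 E2.
  rewrite [LHS]surjective_pairing; congr (_, _).
    rewrite [LHS]/= (_ : q.1 - p.1 = k * jb * (al q + be q)); first by ring.
    by rewrite -E1 /k /=; field; rewrite !gt_eqF.
  rewrite [LHS]/= (_ : q.2 - p.2 = k * ((1 - jd) * al q - (1 - ja) * be q)); first by ring.
  by rewrite -E2 /k /=; field; rewrite !gt_eqF.
have kb0 : 0 <= k * `|be q| by rewrite mulr_ge0// ltW.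
have n1 : `|(k * be q * jb, k * be q * - (1 - ja))| <= k * `|be q| * M.
  have nk y : `|k * be q * y| = k * `|be q| * `|y|.
    by rewrite normrM (normrM k) (gtr0_norm kgt0).
  rewrite prod_normE /= ge_max !nk normrN (gtr0_norm jb_gt0) (gtr0_norm a1).
  by rewrite !ler_wpM2l// /M ?lerDl ?lerDr ltW.
have n2 : `|al q| <= M * `|q - p|.
  have m1 : `|(q - p).1| <= `|q - p| by rewrite prod_normE le_max lexx.
  have m2 : `|(q - p).2| <= `|q - p| by rewrite prod_normE le_max lexx orbT.
  apply: le_trans (ler_normD _ _) _.
  rewrite (normrM (1 - ja)) (normrM jb) (gtr0_norm jb_gt0) (gtr0_norm a1) /M [leRHS]mulrDl [leRHS]addrC.
  by apply: lerD; rewrite ler_pM2l.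
apply: (le_trans n1).
apply: (@le_trans _ _ (k * (e / (k * M * M) * (M * `|q - p|)) * M)).
  rewrite ler_pM2r// ler_pM2l//; apply: le_trans H _; rewrite ler_pM2l//.
rewrite le_eqVlt; apply/orP; left; apply/eqP; field.
by rewrite !gt_eqF.
Qed.

End linearization.

(** * The invariant curve *)

Theorem theorem14 (R : realType) (b1 b2 c1 c2 h1 h2 : R)
    (hb1 : 0 < b1) (hb2 : 0 < b2) (hc1 : 0 < c1) (hc2 : 0 < c2)
    (hh1 : 0 < h1) (hh2 : 0 < h2) (p1 p2 : R * R) :
  let T := sysmap b1 b2 c1 c2 h1 h2 in
  p1 <> p2 ->
  equilibria T = [set p1; p2] ->
  loc_asympt_stable T p1 ->
  non_hyperbolic T p2 ->
  exists C : set (R * R),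
    [/\ C `<=` quadrant, C p2, invariant_set T C & C `<=` basin T p2] /\
    (exists2 a, smaller_eigenvalue (jacobian2 T p2) a &
       tangential C p2 (eigenspace2 (jacobian2 T p2) a)) /\
    (exists (I : set R) (f : R -> R),
       [/\ is_interval I, {within I, continuous f},
           (forall s t, I s -> I t -> s < t -> f s < f t),
           C = graph_on I f &
           forall e, graph_endpoint I f e ->
             (closure (quadrant) `\` (quadrant)^°) e]) /\
    separates C (Wminus C) (Wplus C) /\
    [/\ connected (Wminus C), connected (Wplus C),
        invariant_set T (Wminus C) & invariant_set T (Wplus C)] /\
    ((Wminus C = basin T p1 /\ quadrant `\` Wminus C = basin T p2) \/
     (Wplus C = basin T p1 /\ quadrant `\` Wplus C = basin T p2)) /\
    (forall x, Wminus C x -> \forall n \near \oo, (Q2 p2)^° (iter n T x)) /\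
    (forall x, Wplus C x -> \forall n \near \oo, (Q4 p2)^° (iter n T x)).
Proof.
move=> T p12 eqT las nhyp.
have e1 : equilibria T p1 by rewrite eqT; left.
have e2 : equilibria T p2 by rewrite eqT; right.
(* [s] is [true] when [p1] lies south-east of [p2]. *)
have [s p21] : exists s, le_dir s p2 p1.
  have [?|?] := equilibria_comparable hb1 hc1 hh1 e1 e2.
    by exists false.
  by exists true.
pose B1 := basin T p1; pose C := basin T p2 `&` closure B1.
pose D := quadrant `\` closure B1.
have cut := basin_se_cut hb1 hb2 hc1 hc2 hh1 hh2 p12 eqT las p21.
have Cp := equilibrium_on_boundary hb1 hb2 hc1 hc2 hh1 hh2 p12 eqT las p21.
have BC := boundary_invariant hb1 hb2 hc1 hc2 hh1 hh2 (p1 := p1) (p2 := p2).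
have BB := basin_invariant hb1 hb2 hc1 hc2 hh1 hh2 (p1 := p1).
have BD := exterior_invariant hb1 hb2 hc1 hc2 hh1 hh2 p12 eqT las p21 Cp.
have below := exterior_below hb1 hb2 hc1 hc2 hh1 hh2 p12 eqT las p21 Cp.
have repelled := basin_repelled hb1 hb2 hc1 hc2 hh1 hh2 eqT.
have cover := basin_cover hb1 hb2 hc1 hc2 hh1 hh2 eqT.
have disj := basin_disjoint (b1 := b1) (b2 := b2) (c1 := c1) (c2 := c2) (h1 := h1) (h2 := h2) p12.
rewrite -/T -/B1 -/C -/D in cut Cp BC BB BD below repelled cover disj.
have CQ : C `<=` quadrant by move=> q [[]].
have QT n q : quadrant q -> quadrant (iter n T q) by exact: iter_quadrant.
have inv_iter (A : set (R * R)) n q : invariant_set T A -> A q -> A (iter n T q).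
  by move=> inv Aq; elim: n => //= n IH; apply: inv; exists (iter n T q).
have cutC_eq u v : C u -> C v -> le_se u v -> u = v.
  by move: cut; case: (s) => cut; exact: (cut_le_se_eq cut).
(* The orbit stays in the antichain [C], which contains [p2], so it is never strictly comparable
   with [p2]. *)
have trapped q : C q -> forall n, ~ sidewise p2 (iter n T q).
  move=> Cq n; have Cn := inv_iter _ n _ BC Cq.
  move=> [|] [l1 l2].
    by move: (l1); rewrite (cutC_eq _ _ Cn Cp) ?ltxx//; split; exact: ltW.
  by move: (l1); rewrite (cutC_eq _ _ Cp Cn) ?ltxx//; split; exact: ltW.
have iter_p2 n : iter n T p2 = p2 by exact: iter_equilibrium.
have Q2p : quadrant p2 by case: e2.
have Q1p : quadrant p1 by case: e1.
have lt21 : lt_dir s p2 p1.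
  have i1 : iter 2 T p1 = p1 by exact: iter_equilibrium.
  rewrite -(iter_p2 2) -i1; move: p21; rewrite /lt_dir /le_dir.
  by case: (s) => l; apply: sysmap2_lt => // e; apply: p12; rewrite e.
have evB q : B1 q -> \forall n \near \oo, lt_dir s p2 (iter n T q).
  move=> [_ lim]; apply: lim; move: lt21; rewrite /lt_dir; case: (s) => -[l1 l2].
    exact: filterI (near_fst (lt_nbhsr l1)) (near_snd (lt_nbhsl l2)).
  exact: filterI (near_fst (lt_nbhsl l1)) (near_snd (lt_nbhsr l2)).
have evD q : D q -> \forall n \near \oo, lt_dir s (iter n T q) p2.
  move=> Dq; have [w Cw [qw neq]] := below q Dq.
  have Qq : quadrant q by case: Dq.
  have Qw := CQ _ Cw.
  have limq : iter n T q @[n --> \oo] --> p2 by case: (repelled _ Dq).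
  have limw : iter n T w @[n --> \oo] --> p2 by case: Cw => -[].
  (* Otherwise [q] and the point [w] of the curve would be a trapped ordered pair with both orbits
     tending to [p2]. *)
  have [N side] : exists N, sidewise p2 (iter N T q).
    apply: contrapT => no; have tq n : ~ sidewise p2 (iter n T q).
      by move=> sd; apply: no; exists n.
    have tp := trapped_pair hb1 hb2 hc1 hc2 hh1 hh2 e2 nhyp.
    move: qw; rewrite /le_dir; case: (s) => qw.
      exact: (tp q w Qq Qw qw neq limq limw tq (trapped w Cw)).
    by apply: (tp w q Qw Qq qw _ limw limq (trapped w Cw) tq) => e; apply: neq.
  have DN := inv_iter _ N _ BD Dq.
  have noB : ~ B1 (iter N T q) by case: DN => _ nc /subset_closure.
  (* Points beyond [p2] on the side of [p1] belong to the basin of [p1], which the orbit avoids;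
     only the opposite side is left. *)
  have ltN : lt_dir s (iter N T q) p2.
    move: cut; rewrite /lt_dir; case: (s) => cut; case: side => // -[l1 l2].
      case: noB; apply: (cut_upB cut (or_intror Cp)) => //; first exact: QT.
        by split; exact: ltW.
      by move=> e; move: l1; rewrite -e ltxx.
    case: noB; apply: (cut_downA cut (or_intror Cp)) => //; first exact: QT.
      by split; exact: ltW.
    by move=> e; move: l1; rewrite -e ltxx.
  (* The strict order against the fixed point [p2] persists under iteration. *)
  exists N => // n /= /subnK <-; rewrite iterD -(iter_p2 (n - N)%N).
  move: ltN; rewrite /lt_dir; case: (s) => ltN; apply: iter_se_lt => //; exact: QT.
have B2E : quadrant `\` B1 = basin T p2.
  apply/seteqP; split => [q [Qq nB]|q B2q]; first by case: (cover q Qq).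
  by split; [case: B2q | move=> Bq; exact: disj Bq B2q].
exists C; split; first by split => // q [].
split.
  exists (slope_x b1 c1 p2.1 p2.2 p2.1 p2.2 + slope_x b2 c2 p2.2 p2.1 p2.2 p2.1 - 1).
    exact: jacobian_smaller_eigenvalue.
  exact: trapped_tangential.
move: cut evB evD; rewrite /lt_dir; case: (s) => cut evB evD.
- split; first exact: (cut_graph cut).
  split; first exact: (cut_separates cut Cp).
  rewrite (cut_Wminus cut Cp) (cut_Wplus cut Cp); split.
    by split => //; [exact: (cut_connectedA cut) | exact: (cut_connectedB cut)].
  split; first by right.
  split => q.
    by move=> /evD; apply: filterS => n [l1 l2]; exact: interior_Q2.
  by move=> /evB; apply: filterS => n [l1 l2]; exact: interior_Q4.
- split; first exact: (cut_graph cut).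
  split; first exact: (cut_separates cut Cp).
  rewrite (cut_Wminus cut Cp) (cut_Wplus cut Cp); split.
    by split => //; [exact: (cut_connectedA cut) | exact: (cut_connectedB cut)].
  split; first by left.
  split => q.
    by move=> /evB; apply: filterS => n [l1 l2]; exact: interior_Q2.
  by move=> /evD; apply: filterS => n [l1 l2]; exact: interior_Q4.
Qed.
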